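(* There exists a constant $c>0$ such that for every modulus of continuity $\omega$, for every $f\in(\Lambda_\omega)_+$, and for arbitrary contractions $T$ and $R$ on Hilbert space, the following inequality holds: $$\|f(T)-f(R)\|\le c\,\|f\|_{\Lambda_\omega}\,\omega_*\big(\|T-R\|\big).$$
   Context: A modulus of continuity is a nondecreasing continuous function $\omega$ on $[0,\infty)$ such that $\omega(0)=0$, $\omega(x)>0$ for $x>0$, and $\omega(x+y)\le\omega(x)+\omega(y)$ for $x,y\in[0,\infty)$. $\Lambda_\omega$ is the space of functions $f$ on the unit circle $\mathbb T$ with $$\|f\|_{\Lambda_\omega}=\sup_{\zeta\ne\tau}\frac{|f(\zeta)-f(\tau)|}{\omega(|\zeta-\tau|)}<\infty ,$$ and $(\Lambda_\omega)_+$ is the set of $f\in\Lambda_\omega$ that extend analytically to the unit disk, i.e. $\hat f(n)=0$ for $n<0$; such functions belong to the disk algebra $C_A$ (functions continuous on the closed unit disk and analytic in its interior). For $x>0$, $\omega_*(x)=x\int_x^\infty\frac{\omega(t)}{t^2}\,dt$ (possibly $+\infty$), and $\omega_*(0)=0$. A contraction is an operator of norm at most $1$. For a contraction $T$ and $f\in C_A$, $f(T)$ is defined by the extension of the polynomial functional calculus to $C_A$ by means of von Neumann's inequality $\|f(T)\|\le\|f\|_{C_A}$. *)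

(* Defs.v *)
From HB Require Import structures.
From mathcomp Require Import all_boot all_order all_algebra.
From mathcomp Require Import complex.
From mathcomp Require Import all_classical all_reals all_analysis.
Import Order.TTheory GRing.Theory Num.Theory Num.Def.
Import numFieldNormedType.Exports.
Set Implicit Arguments.
Unset Strict Implicit.
Unset Printing Implicit Defensive.
Local Open Scope classical_set_scope.
Local Open Scope ring_scope.

Definition modulus_of_continuity (R : realType) (w : R -> R) : Prop :=
  [/\ {in `[0, +oo[ &, {homo w : x y / x <= y}},
      {within `[0, +oo[, continuous w},
      w 0 = 0,
      forall x, 0 < x -> 0 < w x
    & forall x y, 0 <= x -> 0 <= y -> w (x + y) <= w x + w y].

Definition omega_star (R : realType) (w : R -> R) (x : R) : \bar R :=
  if x == 0 then 0%E
  else (x%:E * \int[lebesgue_measure]_(t in `[x, +oo[) (w t / t ^+ 2)%:E)%E.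

(* A norm over R[i] takes its values in the nonnegative reals of R[i]; [rnorm]
   reads them in R. *)
Definition rnorm (R : realType) (V : normedZmodType R[i]) (x : V) : R :=
  complex.Re `|x|.

Section Disk.
Variable R : realType.
Local Notation C := (R[i]).

Definition unit_circle : set C := [set z | `|z| = 1].
Definition open_disk : set C := [set z | `|z| < 1].
Definition closed_disk : set C := [set z | `|z| <= 1].

Definition analytic_at (f : C -> C) (z0 : C) : Prop :=
  exists (a : nat -> C) (r : C), 0 < r /\
    forall z, `|z - z0| < r ->
      series (fun n => a n * (z - z0) ^+ n : C^o) @ \oo --> (f z : C^o).

(* Functions on the closed disk are represented by total functions, whose
   values outside the closed disk are irrelevant. *)
Definition disk_algebra (f : C -> C) : Prop :=
  {within (closed_disk : set C^o), continuous (f : C^o -> C^o)} /\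
  (forall z, open_disk z -> analytic_at f z).

Definition Lambda_norm (w : R -> R) (f : C -> C) : \bar R :=
  ereal_sup [set (rnorm (f p.1 - f p.2) / w (rnorm (p.1 - p.2)))%:E
            | p in [set p : C * C |
                [/\ unit_circle p.1, unit_circle p.2 & p.1 != p.2]]].

(* A member of (Lambda_w)_+ is identified with its analytic extension to the
   disk: f lives on the closed disk, and [Lambda_norm] only sees its values on
   the circle. *)
Definition Lambda_plus (w : R -> R) (f : C -> C) : Prop :=
  (Lambda_norm w f < +oo)%E /\ disk_algebra f.

Definition disk_norm (f : C -> C) : \bar R :=
  ereal_sup [set (rnorm (f z))%:E | z in closed_disk].

End Disk.

(* A complete normed space whose norm comes from the inner product [dot],
   which is linear in its first argument. *)
Definition hilbert_dot (R : realType) (H : completeNormedModType R[i])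
    (dot : {dot H for @conjC R[i]}) : Prop :=
  forall x : H, `|x| ^+ 2 = dot x x.

Section Operators.
Variables (R : realType) (H : completeNormedModType R[i]).

Definition opnorm (A : H -> H) : \bar R :=
  ereal_sup [set (rnorm (A x))%:E | x in [set x : H | rnorm x <= 1]].

Definition contraction_op (T : {linear H -> H}) : Prop := (opnorm T <= 1)%E.

Definition poly_op (p : {poly R[i]}) (T : H -> H) : H -> H :=
  fun x => \sum_(i < size p) p`_i *: iter i T x.

Definition is_fcalc (f : R[i] -> R[i]) (T A : H -> H) : Prop :=
  linear A /\
  exists p : nat -> {poly R[i]},
    (disk_norm (fun z => (p n).[z] - f z) @[n --> \oo] --> 0%E) /\
    (opnorm (poly_op (p n) T \- A) @[n --> \oo] --> 0%E).

(* By von Neumann's inequality and the density of polynomials in the disk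
   algebra, exactly one operator satisfies [is_fcalc f T] when f is in the disk
   algebra and T is a contraction. *)
Definition fcalc (f : R[i] -> R[i]) (T : H -> H) : H -> H :=
  get [set A | is_fcalc f T A].

End Operators.

(* Main.v *)
(* The problem is reduced to polynomials [p] approximating [f].  The block operator
   with rows [(T, c(T - S))] and [(0, S)] has norm at most [1 + c ||T - S||], and
   [p] of it has the off-diagonal entry [c (p(T) - p(S))]; after a dilation by
   [rho < 1], von Neumann's inequality bounds [p(rho T) - p(rho S)] by
   [sup |p| ||T - S|| / (1 - rho)].  Now telescope [f] along its dilations
   [f_k(z) = f((1 - 2^-k) z)].  The maximum principle for
   [(f(z) - f(zeta)) / (1 + delta - z conj(zeta))] gives
   [|f(zeta) - f((1 - delta) zeta)| <= 6 L w(delta)] on the circle, so the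
   [k]-th increment contributes a multiple of [2^k w(2^-k) L ||T - S||]; summing
   over [2^-k >= ||T - S||] gives [L omega_*(||T - S||)].  Von Neumann's inequality
   follows from the positivity of [|u|^2 - |A u|^2] at the discrete Fourier
   components of the orbit of a vector under a strict contraction [A], in the
   limit of large period.  Polynomials are dense in the disk algebra because
   the maximum principle (hence Schwarz's lemma) holds for functions that are
   locally sums of power series; averaging over roots of unity gives Cauchy's
   estimates without integration. *)
Require Import Defs.
From HB Require Import structures.
From mathcomp Require Import all_boot all_order all_algebra.
From mathcomp Require Import cyclic separable cyclotomic complex ring lra.
From mathcomp Require Import all_classical all_reals all_analysis measurable_realfun.
Import Order.TTheory GRing.Theory Num.Theory Num.Def.
Import numFieldNormedType.Exports.
Set Implicit Arguments.
Unset Strict Implicit.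
Unset Printing Implicit Defensive.
Local Open Scope classical_set_scope.
Local Open Scope ring_scope.

(** * Roots of unity and von Neumann's inequality *)

(** Already for scalars no fixed multiple of [sup |p| ||T - S||] bounds [p(T) - p(S)] in all degrees
    (take [z^n] near 1), hence the loss of radius: with [1 + delta = 1 / rho] and
    [c = delta / ||T - S||], the block operator becomes a contraction after multiplication by [rho].
    It acts on [H * H], which is why von Neumann's inequality is proved for a positive semidefinite
    form on a bare module. The factor [1 / (1 - rho)] is affordable because the increment between
    the radii [1 - h] and [1 - h / 2] has size of order [w(h)] and is still a dilation by
    [1 - h / 4]. Since [f(T)] is known as a limit of polynomials only, the telescoping estimate
    carries an error [e], sent to 0 while the number of increments stays fixed. Monotonicity of [w]
    makes [2^k w(2^-k)] at most 4 times the integral of [w(t) / t^2] over one dyadic interval;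
    subadditivity gives [w(t) <= (1 + t / d) w(d)], which keeps the quotient in the maximum
    principle bounded on the circle. *)

Lemma prim_root_exists (C : numClosedFieldType) (n : nat) :
  (0 < n)%N -> exists z : C, n.-primitive_root z.
Proof.
pose p : {poly C} := 'X^n - 1; have [r Dp] := closed_field_poly_normal p.
move=> n_gt0; rewrite (monicP _) ?monicXnsubC // scale1r in Dp.
have rn1 : all n.-unity_root r.
  by apply/allP=> z; rewrite -root_prod_XsubC -Dp.
have sz_r : (n < (size r).+1)%N.
  by rewrite -(size_prod_XsubC r id) -Dp size_XnsubC.
have [|z _ zP] := hasP (has_prim_root n_gt0 rn1 _ sz_r); last by exists z.
by rewrite -separable_prod_XsubC -Dp separable_Xn_sub_1 // pnatr_eq0 -lt0n.
Qed.

Lemma prim_root_norm (C : numClosedFieldType) (n : nat) (z : C) i :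
  n.-primitive_root z -> `|z ^+ i| = 1.
Proof.
move=> zP; have n_gt0 := prim_order_gt0 zP.
have : `|z ^+ i| ^+ n = 1.
  by rewrite -normrX exprAC (prim_expr_order zP) expr1n normr1.
by move=> /eqP; rewrite pexpr_eq1 // => /eqP.
Qed.

Lemma prim_root_ortho (C : numClosedFieldType) (n : nat) (z : C) (j k : nat) :
  n.-primitive_root z -> (j < n)%N -> (k < n)%N ->
  \sum_(i < n) (z ^+ i) ^+ j * (z ^+ i) ^- k = (n * (j == k))%:R.
Proof.
move=> zP jn kn; have z0 : z != 0 by rewrite (prim_root_eq0 zP) -lt0n (prim_order_gt0 zP).
pose q := z ^+ j / z ^+ k.
rewrite (eq_bigr (fun i : 'I_n => q ^+ i)); last first.
  by move=> i _; rewrite /q expr_div_n -!exprM ![(i * _)%N]mulnC.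
have [e|jk] := eqVneq j k.
  rewrite (eq_bigr (fun=> 1)).
    by rewrite sumr_const card_ord muln1.
  by move=> i _; rewrite /q e divff ?expr1n // expf_neq0.
rewrite muln0; have q1 : q != 1.
  rewrite /q -subr_eq0 -[X in _ - X](divff (expf_neq0 k z0)) -mulrBl mulf_neq0 //.
    by rewrite subr_eq0 (eq_prim_root_expr zP) !modn_small.
  by rewrite invr_eq0 expf_neq0.
apply: (mulfI (x := q - 1)); first by rewrite subr_eq0.
rewrite mulr0 -subrX1 /q expr_div_n -!exprM ![(_ * n)%N]mulnC !exprM.
by rewrite (prim_expr_order zP) !expr1n divr1 subrr.
Qed.

(** Discrete Parseval: orthogonality of the characters pairs the coefficients of [p] with [g]. The
    bound on [size p] excludes aliasing. *)
Lemma prim_root_transform (C : numClosedFieldType) (n : nat) (z : C) (p : {poly C})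
    (g : nat -> C) :
  n.-primitive_root z -> (size p <= n)%N ->
  \sum_(i < n) p.[z ^+ i] * (\sum_(k < n) (z ^+ i) ^- k * g k) =
  n%:R * \sum_(j < size p) p`_j * g j.
Proof.
move=> zP pn.
transitivity (\sum_(j < n) \sum_(k < n) p`_j * g k *
     \sum_(i < n) (z ^+ i) ^+ j * (z ^+ i) ^- k).
  under eq_bigr => i _ do rewrite (horner_coef_wide _ pn) big_distrlr /=.
  rewrite exchange_big; apply: eq_bigr => j _ /=.
  rewrite exchange_big; apply: eq_bigr => k _ /=.
  by rewrite mulr_sumr; apply: eq_bigr => i _; ring.
rewrite (big_ord_widen n (fun j => p`_j * g j)) // mulr_sumr [RHS]big_mkcond /=.
apply: eq_bigr => j _.
under eq_bigr => k _ do rewrite prim_root_ortho //.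
rewrite (bigD1 j) //= big1 ?addr0; last first.
  by move=> k; rewrite -(inj_eq val_inj) /= eq_sym => /negPf ->; rewrite muln0 mulr0.
rewrite eqxx muln1.
case: ltnP => jp; first by rewrite mulrC.
by rewrite (nth_default _ jp) !mul0r.
Qed.

(** * Positivity of the defect form on discrete Fourier components *)

Section VonNeumann.
Variables (C : numClosedFieldType) (V : lmodType C) (dot : V -> V -> C).
Hypothesis dotD : forall u v w, dot (u + v) w = dot u w + dot v w.
Hypothesis dotZ : forall a u v, dot (a *: u) v = a * dot u v.
Hypothesis dotC : forall u v, dot u v = (dot v u)^*.
Hypothesis dot_ge0 : forall u, 0 <= dot u u.

Let dotDr u v w : dot u (v + w) = dot u v + dot u w.
Proof. by rewrite dotC dotD rmorphD /= -!dotC. Qed.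
Let dotZr a u v : dot u (a *: v) = a^* * dot u v.
Proof. by rewrite dotC dotZ rmorphM /= -dotC. Qed.
Let dotN u v : dot (- u) v = - dot u v.
Proof. by rewrite -scaleN1r dotZ mulN1r. Qed.
Let dotNr u v : dot u (- v) = - dot u v.
Proof. by rewrite dotC dotN rmorphN /= -dotC. Qed.
Let dot0 v : dot 0 v = 0.
Proof. by rewrite -(scale0r (0 : V)) dotZ mul0r. Qed.
Let dot0r v : dot v 0 = 0.
Proof. by rewrite dotC dot0 rmorph0. Qed.
Let dot_suml n (F : 'I_n -> V) v : dot (\sum_i F i) v = \sum_i dot (F i) v.
Proof.
by elim/big_ind2: _ => [|_ x _ y <- <-|//]; rewrite ?dot0 ?dotD.
Qed.
Let dot_sumr n (F : 'I_n -> V) v : dot v (\sum_i F i) = \sum_i dot v (F i).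
Proof.
by elim/big_ind2: _ => [|_ x _ y <- <-|//]; rewrite ?dot0r ?dotDr.
Qed.

(** Expand the square of [t c u - v], where [c] is the unimodular factor turning [dot u v] into its
    modulus. This weighted form does the work of Cauchy-Schwarz without square roots. *)
Lemma dot_amgm (t : C) u v : 0 < t -> 2 * `|dot u v| <= t * dot u u + t^-1 * dot v v.
Proof.
move=> t0.
have [d0|d0] := eqVneq (dot u v) 0.
  by rewrite d0 normr0 mulr0 addr_ge0 // mulr_ge0 ?dot_ge0 // ?invr_ge0 ltW.
pose c : C := `|dot u v| / dot u v.
have cd : c * dot u v = `|dot u v| by rewrite /c mulfVK.
have cc : c * c^* = 1.
  by rewrite -normCK /c normf_div normr_id divff ?expr1n // normr_eq0.
have := dot_ge0 ((t * c) *: u - v).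
rewrite dotD !dotDr !(dotN, dotNr, dotZ, dotZr) rmorphM /=.
rewrite (geC0_conj (ltW t0)) (dotC v u).
have -> : t * c * (t * c^* * dot u u) + - (t * c * dot u v) +
  (- (t * c^* * (dot u v)^*) - - dot v v) =
  t * (t * (c * c^*) * dot u u + t^-1 * dot v v - c * dot u v - (c * dot u v)^*).
  rewrite [conjC (c * _)]rmorphM /=; by field; apply: lt0r_neq0.
rewrite (pmulr_rge0 _ t0) cc mulr1 cd (geC0_conj (normr_ge0 _)) => h.
by rewrite -subr_ge0; apply: le_trans h _; rewrite le_eqVlt; apply/orP; left; apply/eqP; ring.
Qed.

Variable A : {linear V -> V}.
Variable r : C.
Hypothesis r_gt0 : 0 < r.
Hypothesis A_le : forall u, dot (A u) (A u) <= r ^+ 2 * dot u u.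

Lemma dot_iter_le n u : dot (iter n A u) (iter n A u) <= r ^+ (2 * n) * dot u u.
Proof.
elim: n => [|n IH] /=; first by rewrite mul1r.
apply: le_trans (A_le _) _; rewrite mulnS exprD -mulrA ler_pM2l ?exprn_gt0 //.
Qed.

Lemma dot_iter_small n u v : 2 * `|dot u (iter n A v)| <= r ^+ n * (dot u u + dot v v).
Proof.
have rn : 0 < r ^+ n by rewrite exprn_gt0.
apply: le_trans (dot_amgm _ _ rn) _; rewrite mulrDr lerD2l.
rewrite ler_pdivrMl //; apply: le_trans (dot_iter_le _ _) _.
by rewrite mulrA -expr2 -exprM mulnC.
Qed.

(** The form of [1 - A^* A], written without the adjoint. *)
Let defect u v := dot u v - dot (A u) (A v).

(* For [z ^+ M = 1], [spec z x] plays the role of the component of [x] at [z]: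
   it would be an eigenvector of [A] for [z] if [iter M A x] were equal to [x]. *)
Section Spectral.
Variable M : nat.
Let rem x := x - iter M A x.
Let spec z x := \sum_(k < M) z ^- k *: iter k A x.
Let coef x v k := dot (iter k A x) (rem v) + dot (rem x) (iter (M - k) A v).

Let expV (z : C) k : z ^+ M = 1 -> (k <= M)%N -> z ^- k = z ^+ (M - k).
Proof. by move=> zM kM; apply: mulr1_eq; rewrite -exprD subnKC. Qed.

Let spec_rem z x : z ^+ M = 1 ->
  spec z x - rem x = \sum_(k < M) z ^+ k *: iter (M - k) A x.
Proof.
move=> zM; pose f k := z ^- k *: iter k A x.
have fS : \sum_(k < M) f k.+1 = spec z x - rem x.
  have : \sum_(k < M.+1) f k = \sum_(k < M.+1) f k by [].
  rewrite {1}big_ord_recl big_ord_recr /= /f /= expr0 invr1 scale1r zM invr1 scale1r => e.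
  by rewrite /rem opprB addrA -[X in X + _]e [x + _]addrC addrK.
rewrite -fS (reindex_inj rev_ord_inj) /=; apply: eq_bigr => k _.
by rewrite /f -subSn // subSS expV ?leq_subr // subKn // ltnW.
Qed.

Let A_spec z x : z ^+ M = 1 -> A (spec z x) = z *: (spec z x - rem x).
Proof.
move=> zM; rewrite spec_rem // linear_sum scaler_sumr.
rewrite (reindex_inj rev_ord_inj) /=; apply: eq_bigr => k _.
by rewrite linearZ scalerA -exprS /= -iterS -subSn // subSS expV ?leq_subr // subKn.
Qed.

(** On the circle [A] multiplies [spec z x] by [z] up to the error [rem x], so the terms quadratic
    in [spec] cancel. What remains is a trigonometric polynomial in [z]; for [r < 1] and large [M],
    its coefficient of fixed index [k] is close to [dot (iter k A x) v]. *)
Let defect_spec z x v : z ^+ M = 1 -> `|z| = 1 ->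
  defect (spec z x) (spec z v) = \sum_(k < M) z ^- k * coef x v k.
Proof.
move=> zM z1; rewrite /defect !A_spec // dotZ dotZr mulrA -normCK z1 expr1n mul1r.
transitivity (dot (spec z x) (rem v) + dot (rem x) (spec z v - rem v)).
  by rewrite !(dotD, dotDr, dotN, dotNr); ring.
rewrite (spec_rem _ zM) dot_suml dot_sumr -big_split /=; apply: eq_bigr => k _.
rewrite dotZ dotZr mulrDr; congr (_ + _ * _).
by rewrite rmorphXn /= -exprVn invC_norm z1 expr1n invr1 mul1r.
Qed.

Let defectB a u v : defect (a *: u - v) (a *: u - v) =
  `|a| ^+ 2 * defect u u + defect v v - (a * defect u v + (a * defect u v)^*).
Proof.
have dC : (defect u v)^* = defect v u by rewrite /defect rmorphB /= -!dotC.
rewrite rmorphM /= dC normCK /defect linearB linearZ /=.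
by rewrite !(dotD, dotDr, dotN, dotNr, dotZ, dotZr); ring.
Qed.

Hypothesis r_le1 : r <= 1.
Let defect_ge0 u : 0 <= defect u u.
Proof.
rewrite subr_ge0; apply: le_trans (A_le u) _.
by rewrite ler_piMl ?dot_ge0 // expr_le1 // ltW.
Qed.

Variables (p : {poly C}) (B : C).
Hypothesis B_ge : forall z, `|z| = 1 -> `|p.[z]| <= B.
Hypothesis pM : (size p <= M)%N.
Hypothesis M_gt0 : (0 < M)%N.

(** Sum the nonnegative defects of [p(z) spec z x - spec z v] over the [M]-th roots of unity [z]:
    the diagonal terms give [M coef _ _ 0], the cross terms [M P], and [|p(z)| <= B] replaces the
    weight of the first diagonal term. *)
Let transform_le x v P : P = \sum_(j < size p) p`_j * coef x v j ->
  0 <= B ^+ 2 * coef x x 0 + coef v v 0 - (P + P^*).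
Proof.
move=> PE; have [w wP] := prim_root_exists C M_gt0.
have wM i : (w ^+ i) ^+ M = 1 by rewrite exprAC (prim_expr_order wP) expr1n.
have w1 i := prim_root_norm i wP.
have Mgt : 0 < M%:R :> C by rewrite ltr0n.
have T0 u : \sum_(i < M) defect (spec (w ^+ i) u) (spec (w ^+ i) u) = M%:R * coef u u 0.
  have := prim_root_transform (p := 1) (coef u u) wP.
  rewrite size_poly1 => /(_ M_gt0); rewrite big_ord1 coef1 mul1r => <-.
  by apply: eq_bigr => i _; rewrite hornerC mul1r defect_spec.
have TP : \sum_(i < M) p.[w ^+ i] * defect (spec (w ^+ i) x) (spec (w ^+ i) v) = M%:R * P.
  rewrite PE -(prim_root_transform (coef x v) wP pM).
  by apply: eq_bigr => i _; rewrite defect_spec.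
rewrite -(pmulr_rge0 _ Mgt).
have : 0 <= \sum_(i < M) defect (p.[w ^+ i] *: spec (w ^+ i) x - spec (w ^+ i) v)
    (p.[w ^+ i] *: spec (w ^+ i) x - spec (w ^+ i) v).
  by apply: sumr_ge0 => i _.
move=> /le_trans; apply.
rewrite mulrBr mulrDr mulrCA -!T0 mulrDr.
have -> : M%:R * P^* = (M%:R * P)^* by rewrite rmorphM /= conjC_nat.
rewrite -TP raddf_sum /= mulr_sumr -!big_split /= -sumrB; apply: ler_sum => i _.
rewrite defectB lerD2r lerD2r ler_wpM2r //.
by rewrite lerXn2r ?nnegrE ?normr_ge0 ?B_ge // (le_trans (normr_ge0 _) (B_ge (w1 i))).
Qed.

Let coef_approx x v k : (k <= M)%N ->
  `|coef x v k - dot (iter k A x) v| <= 2 * r ^+ (M - k) * (dot x x + dot v v).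
Proof.
move=> kM; have rn n : 0 <= r ^+ n by rewrite exprn_ge0 // ltW.
have r2 n : r ^+ n <= 1 by rewrite exprn_ile1 // ltW.
have it n u : dot (iter n A u) (iter n A u) <= dot u u.
  apply: le_trans (dot_iter_le _ _) _.
  by rewrite -[leRHS]mul1r ler_wpM2r.
have -> : coef x v k - dot (iter k A x) v = - dot (iter k A x) (iter M A v)
   + dot x (iter (M - k) A v) - dot (iter M A x) (iter (M - k) A v).
  by rewrite /coef /rem !(dotD, dotDr, dotN, dotNr); ring.
have t1 n m : (M - k <= m)%N ->
    2 * `|dot (iter n A x) (iter m A v)| <= r ^+ (M - k) * (dot x x + dot v v).
  move=> le_m; apply: le_trans (dot_iter_small _ _ _) _.
  rewrite ler_pM // ?addr_ge0 ?dot_ge0 ?lerD2r //.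
  by rewrite ler_wiXn2l // ltW.
have n1 n : 2 * `|dot (iter n A x) (iter M A v)| <= r ^+ (M - k) * (dot x x + dot v v).
  by apply: t1; rewrite leq_subr.
rewrite -(ler_pM2l (x := 2)) //.
set K := _ + _ in t1 n1 *.
have K0 : 0 <= r ^+ (M - k) * K by rewrite mulr_ge0 // addr_ge0 ?dot_ge0.
apply: (@le_trans _ _ (r ^+ (M - k) * K + r ^+ (M - k) * K + r ^+ (M - k) * K)).
  apply: le_trans (ler_wpM2l (ler0n _ 2) (ler_normB _ _)) _.
  rewrite mulrDr lerD ?t1 //.
  apply: le_trans (ler_wpM2l (ler0n _ 2) (ler_normD _ _)) _.
  by rewrite mulrDr normrN lerD ?n1 // (t1 0).
rewrite -subr_ge0 (_ : _ - _ = r ^+ (M - k) * K) //; ring.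
Qed.

(** For [v = p(A) x] the number [P] of [transform_le] is nearly [dot v v], so positivity reads
    [0 <= B^2 |x|^2 + |v|^2 - 2 |v|^2] up to an error that decays like [r ^+ (M - size p)] as the
    period grows. *)
Lemma vonNeumann_approx x v : v = \sum_(j < size p) p`_j *: iter j A x ->
  dot v v <= B ^+ 2 * dot x x + r ^+ (M - size p) *
    (4 * B ^+ 2 * dot x x + 4 * dot v v +
     4 * \sum_(j < size p) `|p`_j| * (dot x x + dot v v)).
Proof.
move=> vE; set N := size p.
have B0 : 0 <= B := le_trans (normr_ge0 _) (B_ge (normr1 _)).
have rn n : 0 <= r ^+ n by rewrite exprn_ge0 // ltW.
have rmono k : (k <= N)%N -> r ^+ (M - k) <= r ^+ (M - N).
  by move=> kN; rewrite ler_wiXn2l ?(ltW r_gt0) // leq_sub2l.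
have co0 u : `|coef u u 0 - dot u u| <= r ^+ (M - N) * (4 * dot u u).
  apply: le_trans (coef_approx _ _ (leq0n _)) _.
  rewrite (_ : _ * _ = r ^+ (M - 0) * (4 * dot u u)); last by ring.
  by rewrite ler_wpM2r ?rmono // mulr_ge0 ?dot_ge0.
pose P := \sum_(j < N) p`_j * coef x v j.
have PN : `|P - dot v v| <= r ^+ (M - N) *
    (2 * \sum_(j < N) `|p`_j| * (dot x x + dot v v)).
  have -> : P - dot v v = \sum_(j < N) p`_j * (coef x v j - dot (iter j A x) v).
    rewrite {1}vE dot_suml -sumrB; apply: eq_bigr => j _.
    by rewrite dotZ mulrBr.
  rewrite mulrA mulr_sumr.
  apply: le_trans (ler_norm_sum _ _ _) _; apply: ler_sum => j _.
  rewrite normrM mulrCA ler_wpM2l //.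
  apply: le_trans (coef_approx _ _ (leq_trans (ltnW (ltn_ord j)) pM)) _.
  rewrite [2 * _]mulrC ler_wpM2r ?addr_ge0 ?dot_ge0 // ler_wpM2r //.
  by rewrite rmono // ltnW.
have T := transform_le (erefl P).
pose e := B ^+ 2 * (coef x x 0 - dot x x) + (coef v v 0 - dot v v)
  - ((P - dot v v) + (P - dot v v)^*).
have dr u : (dot u u)^* = dot u u by rewrite -dotC.
have eE : B ^+ 2 * coef x x 0 + coef v v 0 - (P + P^*) =
    B ^+ 2 * dot x x - dot v v + e.
  by rewrite /e rmorphB /= dr; ring.
rewrite eE in T.
have eR : e \is Num.real.
  have -> : e = (B ^+ 2 * dot x x - dot v v + e) - (B ^+ 2 * dot x x - dot v v) by ring.
  by rewrite realB ?(ger0_real T) // realB // ger0_real // ?mulr_ge0 ?exprn_ge0.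
have {T} T : dot v v <= B ^+ 2 * dot x x + e by rewrite -subr_ge0 -addrAC.
apply: le_trans T _; rewrite lerD2l; apply: le_trans (real_ler_norm eR) _.
rewrite mulrDr; apply: le_trans (ler_normB _ _) _; apply: lerD.
  apply: le_trans (ler_normD _ _) _; rewrite [leRHS]mulrDr; apply: lerD => //.
  rewrite normrM ger0_norm ?exprn_ge0 //.
  rewrite (_ : r ^+ (M - N) * _ = B ^+ 2 * (r ^+ (M - N) * (4 * dot x x))); last by ring.
  by rewrite ler_wpM2l ?exprn_ge0.
apply: le_trans (ler_normD _ _) _; rewrite norm_conjC.
apply: le_trans (lerD PN PN) _; rewrite le_eqVlt; apply/orP; left; apply/eqP; ring.
Qed.
End Spectral.
End VonNeumann.

(** * Norms and polynomials of operators *)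

Section Rnorm.
Variable R : realType.
Implicit Types V : normedZmodType R[i].

Lemma rnormE V (x : V) : (rnorm x)%:C%C = `|x|.
Proof. by rewrite RRe_real // normr_real. Qed.

Lemma rnorm_ge0 V (x : V) : 0 <= rnorm x.
Proof. by rewrite -ler0c rnormE. Qed.

Lemma rnorm0 V : rnorm (0 : V) = 0.
Proof. by apply: complexI; rewrite rnormE normr0. Qed.

Lemma rnorm_eq0 V (x : V) : rnorm x = 0 -> x = 0.
Proof. by move=> x0; apply/eqP; rewrite -normr_eq0 -rnormE x0. Qed.

Lemma rnormN V (x : V) : rnorm (- x) = rnorm x.
Proof. by rewrite /rnorm normrN. Qed.

Lemma rnormBC V (x y : V) : rnorm (x - y) = rnorm (y - x).
Proof. by rewrite /rnorm distrC. Qed.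

Lemma rnormD V (x y : V) : rnorm (x + y) <= rnorm x + rnorm y.
Proof. by rewrite -lecR rmorphD /= !rnormE ler_normD. Qed.

Lemma rnormB V (x y : V) : rnorm (x - y) <= rnorm x + rnorm y.
Proof. by rewrite -(rnormN y) rnormD. Qed.

Lemma rnorm_sum V (I : Type) (s : seq I) (P : pred I) (F : I -> V) :
  rnorm (\sum_(i <- s | P i) F i) <= \sum_(i <- s | P i) rnorm (F i).
Proof.
elim/big_ind2: _ => [|x a y b xa yb|//]; first by rewrite rnorm0.
exact: le_trans (rnormD _ _) (lerD xa yb).
Qed.

Lemma rnorm1 : rnorm (1 : R[i]) = 1.
Proof. by apply: complexI; rewrite rnormE normr1. Qed.

Lemma rnormM (x y : R[i]) : rnorm (x * y) = rnorm x * rnorm y.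
Proof. by apply: complexI; rewrite rmorphM /= !rnormE normrM. Qed.

Lemma rnormX (x : R[i]) n : rnorm (x ^+ n) = rnorm x ^+ n.
Proof. by apply: complexI; rewrite rmorphXn /= !rnormE normrX. Qed.

Lemma rnormV (x : R[i]) : rnorm x^-1 = (rnorm x)^-1.
Proof. by apply: complexI; rewrite fmorphV /= !rnormE normfV. Qed.

Lemma rnorm_real (a : R) : 0 <= a -> rnorm (a%:C%C : R[i]) = a.
Proof. by move=> a0; apply: complexI; rewrite rnormE ger0_norm // ler0c. Qed.

Lemma rnormZ (V : normedModType R[i]) (a : R[i]) (x : V) :
  rnorm (a *: x) = rnorm a * rnorm x.
Proof. by apply: complexI; rewrite rmorphM /= !rnormE normrZ. Qed.

Lemma rnorm_eq1 (z : R[i]) : (rnorm z = 1) <-> (`|z| = 1).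
Proof.
split=> [z1|z1]; first by rewrite -rnormE z1.
by apply: complexI; rewrite rnormE z1.
Qed.

End Rnorm.

(** The formula of [poly_op] over an arbitrary module, so that it also covers the block operator on
    [V * V]. *)
Definition poly_act (C : comNzRingType) (V : lmodType C)
    (p : {poly C}) (T : V -> V) (x : V) : V :=
  \sum_(i < size p) p`_i *: iter i T x.

Section PolyAct.
Variables (C : fieldType) (V : lmodType C).
Implicit Types (p q : {poly C}) (T : V -> V).

Lemma poly_act_wide n p T x : (size p <= n)%N ->
  poly_act p T x = \sum_(i < n) p`_i *: iter i T x.
Proof.
move=> pn; rewrite /poly_act (big_ord_widen n (fun i => p`_i *: iter i T x)) //.
rewrite [LHS]big_mkcond /=; apply: eq_bigr => i _; case: ltnP => // pi.
by rewrite nth_default // scale0r.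
Qed.

Lemma poly_actB p q T x : poly_act (p - q) T x = poly_act p T x - poly_act q T x.
Proof.
pose n := maxn (size p) (size q).
rewrite !(@poly_act_wide n) ?leq_maxl ?leq_maxr //; last first.
  by rewrite (leq_trans (size_polyD _ _)) // size_polyN.
by rewrite -sumrB; apply: eq_bigr => i _; rewrite coefB scalerBl.
Qed.

Lemma poly_act_linear p (T : {linear V -> V}) : linear (poly_act p T).
Proof.
move=> a x y; rewrite /poly_act scaler_sumr -big_split; apply: eq_bigr => i _ /=.
rewrite scalerA mulrC -scalerA -scalerDr; congr (_ *: _).
by elim: (nat_of_ord i) => //= k ->; rewrite linearP.
Qed.

Lemma coef_scale p c i : (p \Po (c *: 'X))`_i = p`_i * c ^+ i.
Proof.
rewrite comp_polyE coef_sum; under eq_bigr => j _ do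
  rewrite exprZn !coefZ coefXn.
have [pi|ip] := leqP (size p) i.
  rewrite big1 ?nth_default ?mul0r // => j _.
  by rewrite gtn_eqF ?mulr0 // (leq_trans (ltn_ord j)).
rewrite (bigD1 (Ordinal ip)) //= eqxx mulr1 big1 ?addr0 // => j.
by rewrite -(inj_eq val_inj) /= eq_sym => /negPf ->; rewrite !mulr0.
Qed.

Lemma size_scale p c : (size (p \Po (c *: 'X)) <= size p)%N.
Proof. by apply/leq_sizeP => j pj; rewrite coef_scale nth_default ?mul0r. Qed.

Lemma horner_scale p c z : (p \Po (c *: 'X)).[z] = p.[c * z].
Proof. by rewrite horner_comp hornerZ hornerX. Qed.

Lemma iter_scale (T : {linear V -> V}) c n x :
  iter n (fun y => c *: T y) x = c ^+ n *: iter n T x.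
Proof.
elim: n => [|n IH] /=; first by rewrite scale1r.
by rewrite IH linearZ scalerA exprS.
Qed.

Lemma poly_act_scale p (T : {linear V -> V}) c x :
  poly_act (p \Po (c *: 'X)) T x = poly_act p (fun y => c *: T y) x.
Proof.
rewrite (poly_act_wide _ _ (size_scale p c)); apply: eq_bigr => i _.
by rewrite coef_scale iter_scale scalerA.
Qed.

End PolyAct.

Lemma geom_cvg0_le (R : realType) (a b k r : R) : 0 <= r -> r < 1 ->
  (forall n, a <= b + r ^+ n * k) -> a <= b.
Proof.
move=> r0 r1 H.
have : b + r ^+ n * k @[n --> \oo] --> b + 0 * k.
  apply: cvgD; first exact: cvg_cst.
  apply: cvgM; last exact: cvg_cst.
  by apply: cvg_expr; rewrite ger0_norm.
rewrite mul0r addr0 => /cvg_lim <- //.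
apply: limr_ge.
  apply: is_cvgD; first exact: is_cvg_cst.
  apply: is_cvgM; last exact: is_cvg_cst.
  by apply/cvg_ex; exists 0; apply: cvg_expr; rewrite ger0_norm.
by near=> n; exact: H.
Unshelve. all: by end_near. Qed.

(** Right continuity at 1. It carries von Neumann's inequality from the strict contractions
    [s^-1 T], [s > 1], to [T] itself. *)
Lemma horner_ge_at1 (R : realType) (P : {poly R}) (a : R) :
  (forall s, 1 < s -> a <= P.[s]) -> a <= P.[1].
Proof.
move=> H; rewrite leNgt; apply/negP => lt.
have : \forall s \near 1^'+, P.[s] < a.
  apply: (@cvgr_lt _ _ _ _ (fun s => P.[s]) P.[1]) => //.
  by apply: cvg_at_right_filter; exact: continuous_horner.
move=> F.
have : \forall s \near (1 : R)^'+, False.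
  near=> s; have := H s; rewrite leNgt => /(_ _)/negP; apply.
    by near: s; exact: nbhs_right_gt.
  by near: s.
by move=> /filter_ex [].
Unshelve. all: by end_near. Qed.

(** * Von Neumann's inequality for a semi-inner product *)

Section VonNeumannInequality.
Variables (R : realType) (V : lmodType R[i]) (dot : V -> V -> R[i]).
Hypothesis dotD : forall u v w, dot (u + v) w = dot u w + dot v w.
Hypothesis dotZ : forall a u v, dot (a *: u) v = a * dot u v.
Hypothesis dotC : forall u v, dot u v = (dot v u)^*.
Hypothesis dot_ge0 : forall u, 0 <= dot u u.
Let nsq u := complex.Re (dot u u).
Let nsqE u : (nsq u)%:C%C = dot u u.
Proof. by rewrite RRe_real // ger0_real. Qed.

Let nsqZ (c : R) u : nsq (c%:C%C *: u) = c ^+ 2 * nsq u.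
Proof.
apply: complexI; rewrite nsqE dotZ [dot u _]dotC dotZ rmorphM /= -dotC.
rewrite mulrA -normCK rmorphM rmorphXn /= nsqE; congr (_ * _).
by rewrite real_normK // complex_real.
Qed.

Lemma vonNeumann_strict (A : {linear V -> V}) (r : R) (p : {poly R[i]}) (B : R) x :
  0 < r -> r < 1 -> (forall u, nsq (A u) <= r ^+ 2 * nsq u) ->
  (forall z, rnorm z = 1 -> rnorm p.[z] <= B) ->
  nsq (poly_act p A x) <= B ^+ 2 * nsq x.
Proof.
move=> r0 r1 Ar pB; set v := poly_act p A x.
have r0' : 0 < r%:C%C by rewrite ltcR.
have r1' : r%:C%C <= 1 by rewrite lecR ltW.
have Ar' u : dot (A u) (A u) <= (r%:C)%C ^+ 2 * dot u u.
  by rewrite -!nsqE -rmorphXn -rmorphM lecR.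
have pB' z : `|z| = 1 -> `|p.[z]| <= B%:C%C.
  by rewrite -rnormE lecR => /rnorm_eq1/pB.
have B0 : 0 <= B%:C%C.
  by rewrite ler0c (le_trans (rnorm_ge0 _) (pB 1 (rnorm1 _))).
pose K := (4 * B%:C%C ^+ 2 * dot x x + 4 * dot v v +
     4 * \sum_(j < size p) `|p`_j| * (dot x x + dot v v)).
have K0 : 0 <= K.
  rewrite !addr_ge0 // ?mulr_ge0 // ?exprn_ge0 //.
  by apply: sumr_ge0 => j _; rewrite mulr_ge0 // addr_ge0.
have KE : (complex.Re K)%:C%C = K by rewrite RRe_real // ger0_real.
apply: (geom_cvg0_le (k := complex.Re K) (ltW r0) r1) => n.
(* The period is [n.+1 + size p], so the error in [vonNeumann_approx] carries the factor
   [r ^+ n.+1]. *)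
have M0 : (0 < n.+1 + size p)%N by rewrite addSn.
have := vonNeumann_approx dotD dotZ dotC dot_ge0 r0' Ar' r1' pB' (leq_addl n.+1 (size p)) M0 (erefl v).
rewrite addnK -/K -KE -!nsqE -!rmorphXn -!rmorphM -rmorphD lecR.
move=> /le_trans; apply.
rewrite lerD2l ler_wpM2r //; first by rewrite -ler0c KE.
by rewrite ler_wiXn2l // ltW.
Qed.


Theorem vonNeumann (T : {linear V -> V}) (p : {poly R[i]}) (B : R) x :
  (forall u, nsq (T u) <= nsq u) ->
  (forall z, rnorm z = 1 -> rnorm p.[z] <= B) ->
  nsq (poly_act p T x) <= B ^+ 2 * nsq x.
Proof.
move=> T1 pB.
(* On the circle [|p(s z)|] exceeds [|p(z)|] by at most the sum of [|p_j| (s^j - 1)]. The resulting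
   bound is a polynomial in [s] with the desired value at [s = 1]. *)
pose P : {poly R} := (B%:P + \sum_(j < size p) rnorm p`_j *: ('X^j - 1)) ^+ 2 * (nsq x)%:P.
have PE s : P.[s] = (B + \sum_(j < size p) rnorm p`_j * (s ^+ j - 1)) ^+ 2 * nsq x.
  rewrite /P !hornerE horner_sum; congr ((_ + _) ^+ 2 * _).
  by apply: eq_bigr => j _; rewrite !hornerE.
suff H s : 1 < s -> nsq (poly_act p T x) <= P.[s].
  have := horner_ge_at1 H; rewrite PE big1 ?addr0 // => j _.
  by rewrite expr1n subrr mulr0.
move=> s1; have s0 : 0 < s by apply: lt_trans s1.
have s0' : (s%:C)%C != 0 by rewrite (inj_eq (@complexI R) _ 0) gt_eqF.
have -> : poly_act p T x = poly_act (p \Po (s%:C%C *: 'X)) ((s^-1)%:C%C \*: T) x.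
  rewrite -poly_act_scale -comp_polyA comp_polyZ comp_polyX scalerA.
  by rewrite -rmorphM /= mulfV ?gt_eqF // scale1r comp_polyXr.
rewrite PE; apply: (vonNeumann_strict (r := s^-1)).
- by rewrite invr_gt0.
- by rewrite invf_lt1.
- move=> u; rewrite [X in nsq X](_ : _ = (s^-1)%:C%C *: T u) // nsqZ.
  by rewrite ler_wpM2l // sqr_ge0.
move=> z z1; rewrite horner_scale.
have -> : p.[s%:C%C * z] = p.[z] + \sum_(j < size p) p`_j * (((s%:C)%C ^+ j - 1) * z ^+ j).
  rewrite !horner_coef -big_split; apply: eq_bigr => j _ /=.
  by rewrite exprMn; ring.
apply: le_trans (rnormD _ _) _; apply: lerD; first exact: pB.
apply: le_trans (rnorm_sum _ _ _) _; apply: ler_sum => j _.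
rewrite !rnormM rnormX z1 expr1n mulr1 ler_wpM2l ?rnorm_ge0 //.
rewrite -rmorphXn -(rmorph1 (real_complex R)) -rmorphB /= rnorm_real //.
by rewrite subr_ge0 exprn_ege1 // ltW.
Qed.
End VonNeumannInequality.

(** * The block operator and differences of polynomials of two contractions *)

Section Bernstein.
Variables (R : realType) (V : lmodType R[i]) (dot : V -> V -> R[i]).
Hypothesis dotD : forall u v w, dot (u + v) w = dot u w + dot v w.
Hypothesis dotZ : forall a u v, dot (a *: u) v = a * dot u v.
Hypothesis dotC : forall u v, dot u v = (dot v u)^*.
Hypothesis dot_ge0 : forall u, 0 <= dot u u.
Let nsq u := complex.Re (dot u u).
Let nsqE u : (nsq u)%:C%C = dot u u.
Proof. by rewrite RRe_real // ger0_real. Qed.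

Let nsqZ (c : R) u : nsq (c%:C%C *: u) = c ^+ 2 * nsq u.
Proof.
apply: complexI; rewrite nsqE dotZ [dot u _]dotC dotZ rmorphM /= -dotC.
rewrite mulrA -normCK rmorphM rmorphXn /= nsqE; congr (_ * _).
by rewrite real_normK // complex_real.
Qed.

Let nsqD (t : R) u v : 0 < t ->
  nsq (u + v) <= (1 + t) * nsq u + (1 + t^-1) * nsq v.
Proof.
move=> t0; have dotDr a b c : dot a (b + c) = dot a b + dot a c.
  by rewrite dotC dotD rmorphD /= -!dotC.
have dotZr a b c : dot b (a *: c) = a^* * dot b c.
  by rewrite dotC dotZ rmorphM /= -dotC.
have tC : 0 < t%:C%C by rewrite ltcR.
rewrite -lecR rmorphD !rmorphM !rmorphD rmorph1 /= fmorphV !nsqE -subr_ge0.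
have -> : (1 + t%:C)%C * dot u u + (1 + (t%:C%C)^-1) * dot v v - dot (u + v) (u + v) =
    (t%:C%C)^-1 * dot (t%:C%C *: u + (- 1) *: v) (t%:C%C *: u + (- 1) *: v).
  rewrite !(dotD, dotDr, dotZ, dotZr) rmorphN1 (geC0_conj (ltW tC)).
  by field; apply: lt0r_neq0.
by rewrite mulr_ge0 // invr_ge0 ltW.
Qed.

Variables T S : {linear V -> V}.

(* [block_op c] is similar to the diagonal operator [(T, S)], so that a
   polynomial in it has [c *: (p(T) - p(S))] as its off-diagonal entry. *)
Definition block_op (c : R[i]) (u : V * V) : V * V :=
  (T u.1 + c *: (T u.2 - S u.2), S u.2).

Lemma block_op_linear c : linear (block_op c).
Proof.
move=> a [x y] [x' y']; rewrite /block_op /=; congr pair; last by rewrite (linearP S).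
rewrite [RHS](_ : _ = a *: (T x + c *: (T y - S y)) + (T x' + c *: (T y' - S y'))) //.
have -> : T (a *: y + y') - S (a *: y + y') = a *: (T y - S y) + (T y' - S y').
  by rewrite (linearP T) (linearP S) opprD addrACA scalerBr.
rewrite (linearP T) [c *: (_ + _)]scalerDr [a *: (T x + _)]scalerDr !scalerA.
by rewrite [a * c]mulrC addrACA.
Qed.

HB.instance Definition _ c :=
  GRing.isLinear.Build R[i] (V * V)%type (V * V)%type *:%R (block_op c) (block_op_linear c).

Lemma iter_block_op c n x y :
  iter n (block_op c) (x, y) =
  (iter n T x + c *: (iter n T y - iter n S y), iter n S y).
Proof.
elim: n => [|n IH] /=; first by rewrite subrr scaler0 addr0.
rewrite IH /block_op /= linearD linearZ linearB /= -addrA -scalerDr.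
by rewrite addrA subrK.
Qed.

Lemma poly_act_block_op c p y :
  poly_act p (block_op c) (0, y) =
  (c *: (poly_act p T y - poly_act p S y), poly_act p S y).
Proof.
have T0 n : iter n T 0 = 0 by elim: n => //= n ->; rewrite linear0.
rewrite /poly_act -sumrB scaler_sumr [LHS]surjective_pairing; congr pair.
  rewrite (raddf_sum fst) /=; apply: eq_bigr => i _.
  by rewrite iter_block_op T0 add0r /= scalerA mulrC -scalerA scalerBr.
rewrite (raddf_sum snd) /=; apply: eq_bigr => i _.
by rewrite iter_block_op.
Qed.

Let dot2 (u v : V * V) := dot u.1 v.1 + dot u.2 v.2.
Let nsq2 u : complex.Re (dot2 u u) = nsq u.1 + nsq u.2.
Proof. by apply: complexI; rewrite RRe_real ?ger0_real ?addr_ge0 // rmorphD /= !nsqE. Qed.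

(** An operator analogue of Cauchy's bound [B / (1 - rho)] for a derivative at distance [1 - rho]
    from the circle, with [d] as the increment. *)
Theorem bernstein (p : {poly R[i]}) (B d rho : R) y :
  (forall u, nsq (T u) <= nsq u) -> (forall u, nsq (S u) <= nsq u) ->
  0 < d -> (forall u, nsq (T u - S u) <= d ^+ 2 * nsq u) ->
  0 < rho -> rho < 1 ->
  (forall z, rnorm z = 1 -> rnorm p.[z] <= B) ->
  nsq (poly_act (p \Po (rho%:C%C *: 'X)) T y - poly_act (p \Po (rho%:C%C *: 'X)) S y)
  <= (B * d / (1 - rho)) ^+ 2 * nsq y.
Proof.
move=> T1 S1 d0 TS rho0 rho1 pB.
have nsq_ge0 u : 0 <= nsq u by rewrite -ler0c nsqE.
have B0 : 0 <= B := le_trans (rnorm_ge0 _) (pB 1 (rnorm1 _)).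
(* Thus [1 + delta = 1 / rho], and [c = delta / d] is the scaling at which the corner entry
   [c (T - S)] has norm at most [delta]. The weight [delta] in [nsqD] then bounds the block operator
   by [1 / rho]. *)
pose delta := rho^-1 - 1; have delta0 : 0 < delta by rewrite subr_gt0 invf_gt1.
pose c := delta / d; have c0 : 0 < c by rewrite divr_gt0.
have cN u : nsq (block_op c%:C%C u).1 + nsq (block_op c%:C%C u).2 <=
    rho ^- 2 * (nsq u.1 + nsq u.2).
  have -> : rho ^- 2 = (1 + delta) ^+ 2 by rewrite /delta addrC subrK exprVn.
  have h1 := nsqD (T u.1) (c%:C%C *: (T u.2 - S u.2)) delta0.
  have h2 : (1 + delta^-1) * nsq (c%:C%C *: (T u.2 - S u.2)) <= (delta ^+ 2 + delta) * nsq u.2.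
    rewrite nsqZ /c.
    apply: (@le_trans _ _ ((1 + delta^-1) * (delta / d) ^+ 2 * (d ^+ 2 * nsq u.2))).
      rewrite mulrA ler_wpM2l ?TS //.
      by rewrite mulr_ge0 ?sqr_ge0 // addr_ge0 // invr_ge0 ltW.
    rewrite le_eqVlt; apply/orP; left; apply/eqP; field.
    by rewrite !gt_eqF.
  have h3 : (1 + delta) * nsq (T u.1) <= (1 + delta) * nsq u.1.
    by rewrite ler_wpM2l ?T1 // addr_ge0 // ltW.
  have := S1 u.2; rewrite /block_op /=; move: (nsq_ge0 u.1) (nsq_ge0 u.2) => n1 n2 h4.
  by move: h1 h2 h3 h4; nra.
have := @vonNeumann R (V * V)%type dot2 _ _ _ _ (rho%:C%C \*: block_op c%:C%C) p B (0, y) _ pB.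
rewrite -[poly_act p _ (0, y)](poly_act_scale p (block_op c%:C%C)) poly_act_block_op.
rewrite !nsq2 /= => vN.
suff : nsq (c%:C%C *: (poly_act (p \Po (rho%:C%C *: 'X)) T y -
    poly_act (p \Po (rho%:C%C *: 'X)) S y)) <= B ^+ 2 * nsq y.
  rewrite nsqZ; set D := nsq (_ - _) => h.
  have : D <= (B / c) ^+ 2 * nsq y.
    by rewrite expr_div_n mulrAC ler_pdivlMr ?exprn_gt0 // mulrC.
  move=> /le_trans; apply; rewrite ler_wpM2r //.
  (* Dividing the corner entry by [c] produces the factor [d / (1 - rho)]; the additional [rho < 1]
     is dropped. *)
  have ci : c^-1 = rho * (d / (1 - rho)).
    by rewrite /c /delta; field; rewrite !gt_eqF ?subr_gt0.
  have di : 0 <= d / (1 - rho) by rewrite divr_ge0 ?subr_ge0 // ltW.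
  rewrite -mulrA ci; move: (d / (1 - rho)) di => e e0; rewrite [B * (rho * e)]mulrA.
  rewrite lerXn2r ?nnegrE ?mulr_ge0 ?(ltW rho0) //.
  by rewrite mulrAC ler_piMr ?mulr_ge0 ?(ltW rho1).
rewrite -[leLHS]addr0.
apply: le_trans (lerD (lexx _) (nsq_ge0 (poly_act (p \Po (rho%:C%C *: 'X)) S y))) _.
have nsq0 : nsq 0 = 0 by rewrite -(scale0r 0) -(rmorph0 (real_complex R)) nsqZ expr0n mul0r.
rewrite -[in leRHS](add0r (nsq y)) -[in leRHS]nsq0; apply: vN.
- by move=> u v w; rewrite /dot2 !dotD addrACA.
- by move=> a u v; rewrite /dot2 !dotZ mulrDr.
- by move=> u v; rewrite /dot2 rmorphD /= -!dotC.
- by move=> u; rewrite addr_ge0.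
move=> u; rewrite !nsq2.
rewrite (_ : nsq (_ *: _).1 = rho ^+ 2 * nsq (block_op c%:C%C u).1); last exact: nsqZ.
rewrite (_ : nsq (_ *: _).2 = rho ^+ 2 * nsq (block_op c%:C%C u).2); last exact: nsqZ.
by rewrite -mulrDr mulrC -ler_pdivlMr ?exprn_gt0 // mulrC.
Qed.
End Bernstein.

(** * Norm estimates on Hilbert space and telescoping over radii *)

Section HilbertOperators.
Variables (R : realType) (H : completeNormedModType R[i]).
Variable dot : {dot H for @conjC R[i]}.
Hypothesis Hdot : hilbert_dot dot.

Let dotD u v w : dot (u + v) w = dot u w + dot v w.
Proof. exact: linearDl. Qed.
Let dotZ a u v : dot (a *: u) v = a * dot u v.
Proof. exact: linearZl_LR. Qed.
Let dotC u v : dot u v = (dot v u)^*.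
Proof. by rewrite hermC expr0 mul1r. Qed.
Let dot_ge0 u : 0 <= dot u u.
Proof. by rewrite -Hdot exprn_ge0. Qed.
Let nsqE u : complex.Re (dot u u) = rnorm u ^+ 2.
Proof. by apply: complexI; rewrite RRe_real ?ger0_real // -Hdot rmorphXn /= rnormE. Qed.

Lemma vonNeumann_rnorm (T : {linear H -> H}) (p : {poly R[i]}) (B : R) x :
  (forall u, rnorm (T u) <= rnorm u) ->
  (forall z, rnorm z = 1 -> rnorm p.[z] <= B) ->
  rnorm (poly_act p T x) <= B * rnorm x.
Proof.
move=> T1 pB; have B0 : 0 <= B := le_trans (rnorm_ge0 _) (pB 1 (rnorm1 _)).
have T1' u : complex.Re (dot (T u) (T u)) <= complex.Re (dot u u).
  by rewrite !nsqE lerXn2r ?nnegrE ?rnorm_ge0.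
have := vonNeumann dotD dotZ dotC dot_ge0 x T1' pB.
by rewrite !nsqE -exprMn ler_pXn2r ?nnegrE ?mulr_ge0 ?rnorm_ge0.
Qed.

Variables T S : {linear H -> H}.
Hypothesis T1 : forall u, rnorm (T u) <= rnorm u.
Hypothesis S1 : forall u, rnorm (S u) <= rnorm u.

Lemma bernstein_rnorm (p : {poly R[i]}) (B d rho : R) y :
  0 < d -> (forall u, rnorm (T u - S u) <= d * rnorm u) ->
  0 < rho -> rho < 1 ->
  (forall z, rnorm z = 1 -> rnorm p.[z] <= B) ->
  rnorm (poly_act (p \Po (rho%:C%C *: 'X)) T y - poly_act (p \Po (rho%:C%C *: 'X)) S y)
  <= B * d / (1 - rho) * rnorm y.
Proof.
move=> d0 TS rho0 rho1 pB; have B0 : 0 <= B := le_trans (rnorm_ge0 _) (pB 1 (rnorm1 _)).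
have T1' u : complex.Re (dot (T u) (T u)) <= complex.Re (dot u u).
  by rewrite !nsqE lerXn2r ?nnegrE ?rnorm_ge0.
have S1' u : complex.Re (dot (S u) (S u)) <= complex.Re (dot u u).
  by rewrite !nsqE lerXn2r ?nnegrE ?rnorm_ge0.
have TS' u : complex.Re (dot (T u - S u) (T u - S u)) <= d ^+ 2 * complex.Re (dot u u).
  by rewrite !nsqE -exprMn lerXn2r ?nnegrE ?rnorm_ge0 // mulr_ge0 ?rnorm_ge0 ?ltW.
have := bernstein dotD dotZ dotC dot_ge0 y T1' S1' d0 TS' rho0 rho1 pB.
rewrite !nsqE -exprMn ler_pXn2r ?nnegrE ?mulr_ge0 ?rnorm_ge0 ?(ltW d0) //.
by rewrite invr_ge0 subr_ge0 ltW.
Qed.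

Variables (p : {poly R[i]}) (W : R -> R) (e d : R).
Hypothesis W_mono : forall x y, 0 <= x -> x <= y -> W x <= W y.
Hypothesis pW : forall z r, rnorm z = 1 -> 0 <= r -> r <= 1 ->
  rnorm (p.[z] - p.[r%:C%C * z]) <= W (1 - r) + e.
Hypothesis d_gt0 : 0 < d.
Hypothesis TS : forall u, rnorm (T u - S u) <= d * rnorm u.

Let dil (r : R) := p \Po (r%:C%C *: 'X).
Let D r x := poly_act (dil r) T x - poly_act (dil r) S x.

Let D0 x : D 0 x = 0.
Proof.
rewrite /D /dil scale0r /poly_act comp_poly0r size_polyC.
by case: eqP => _ /=; rewrite ?big_ord0 ?big_ord1 subrr.
Qed.

(** The increment is [p(a z) - p(b z)] dilated by [rho]. Its sup on the circle is at most
    [2 (W h + e)], and [1 - rho = h / 4] turns the factor 2 into 8. Here [e] absorbs the error made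
    when [p] stands for a function with radial modulus [W]. *)
Let D_step (h : R) x : 0 < h -> h <= 1 ->
  rnorm (D (1 - h / 2) x - D (1 - h) x) <= 8 * (W h + e) / h * d * rnorm x.
Proof.
(* This radius lies outside both [1 - h / 2] and [1 - h], yet [1 - b = (3 h / 4) / (1 - h / 4)]
   stays below [h] because [h <= 1]. *)
move=> h0 h1; pose rho := 1 - h / 4.
have rho0 : 0 < rho by rewrite /rho; lra.
have rho1 : rho < 1 by rewrite /rho; lra.
pose a := (1 - h / 2) / rho; pose b := (1 - h) / rho.
have ea : dil (1 - h / 2) = dil a \Po (rho%:C%C *: 'X).
  rewrite /dil -comp_polyA comp_polyZ comp_polyX scalerA -rmorphM /= /a.
  by rewrite mulfVK // gt_eqF.
have eb : dil (1 - h) = dil b \Po (rho%:C%C *: 'X).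
  rewrite /dil -comp_polyA comp_polyZ comp_polyX scalerA -rmorphM /= /b.
  by rewrite mulfVK // gt_eqF.
have a0 : 0 <= a by rewrite divr_ge0 ?(ltW rho0) //; lra.
have b0 : 0 <= b by rewrite divr_ge0 ?(ltW rho0) //; lra.
have a1 : a <= 1 by rewrite ler_pdivrMr // /rho; lra.
have b1 : b <= 1 by rewrite ler_pdivrMr // /rho; lra.
have ah : 1 - a <= h by rewrite lerBlDr -lerBlDl ler_pdivlMr // /rho; nra.
have bh : 1 - b <= h by rewrite lerBlDr -lerBlDl ler_pdivlMr // /rho; nra.
have g_le z : rnorm z = 1 -> rnorm (dil a - dil b).[z] <= 2 * (W h + e).
  move=> z1; rewrite hornerD hornerN !horner_scale.
  rewrite (_ : _ - _ = (p.[z] - p.[b%:C%C * z]) - (p.[z] - p.[a%:C%C * z])); last by ring.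
  apply: le_trans (rnormB _ _) _.
  have ha := pW z1 a0 a1; have hb := pW z1 b0 b1.
  have wa : W (1 - a) <= W h by apply: W_mono; lra.
  have wb : W (1 - b) <= W h by apply: W_mono; lra.
  by lra.
have := bernstein_rnorm x d_gt0 TS rho0 rho1 g_le.
rewrite comp_polyB -ea -eb !poly_actB => /le_trans h2.
rewrite (_ : D _ x - D _ x = poly_act (dil (1 - h / 2)) T x - poly_act (dil (1 - h)) T x -
  (poly_act (dil (1 - h / 2)) S x - poly_act (dil (1 - h)) S x)); last first.
  by rewrite /D !opprB [LHS]addrACA [RHS]addrACA [- _ - _]addrC.
apply: h2; rewrite le_eqVlt; apply/orP; left; apply/eqP; congr (_ * _).
by rewrite /rho; field; rewrite !gt_eqF //; lra.
Qed.

Let half_pow k : 0 < (2^-1 : R) ^+ k /\ (2^-1 : R) ^+ k <= 1.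
Proof.
by split; rewrite ?exprn_gt0 ?invr_gt0 ?ltr0n // exprn_ile1 ?invr_ge0 ?invf_le1 ?ler1n.
Qed.

(* Telescoping along the radii [1 - 2^-k], [k <= N]: each increment is handled by
   [bernstein_rnorm], the remainder by von Neumann's inequality. *)
Lemma poly_act_modulus N x :
  rnorm (poly_act p T x - poly_act p S x) <=
  (\sum_(k < N) 8 * (W (2^-1 ^+ k) + e) / 2^-1 ^+ k * d
   + 2 * (W (2^-1 ^+ N) + e)) * rnorm x.
Proof.
have DN : rnorm (D (1 - 2^-1 ^+ N) x) <=
    (\sum_(k < N) 8 * (W (2^-1 ^+ k) + e) / 2^-1 ^+ k * d) * rnorm x.
  elim: N => [|N IH].
    by rewrite expr0 subrr D0 rnorm0 big_ord0 mul0r.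
  rewrite big_ord_recr /= mulrDl.
  rewrite -[D _ x](addrNK (D (1 - 2^-1 ^+ N) x)) addrC.
  apply: le_trans (rnormD _ _) _; apply: lerD IH _.
  have [h0 h1] := half_pow N.
  by rewrite exprSr; apply: D_step.
have [h0 h1] := half_pow N; set h := 2^-1 ^+ N in DN h0 h1 *.
have tail (U : {linear H -> H}) : (forall u, rnorm (U u) <= rnorm u) ->
    rnorm (poly_act p U x - poly_act (dil (1 - h)) U x) <= (W h + e) * rnorm x.
  move=> U1; rewrite -poly_actB; apply: vonNeumann_rnorm => // z z1.
  rewrite hornerD hornerN horner_scale -[h in W h](subKr 1).
  by apply: pW; rewrite // ?subr_ge0 // lerBlDr lerDl ltW.
have tT := tail T T1; have tS := tail S S1.
rewrite (_ : _ - _ = (poly_act p T x - poly_act (dil (1 - h)) T x) + D (1 - h) x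
   - (poly_act p S x - poly_act (dil (1 - h)) S x)); last first.
  by rewrite /D addrA subrK opprB addrA addrNK.
apply: le_trans (rnormB _ _) _; apply: le_trans (lerD (rnormD _ _) (lexx _)) _.
by lra.
Qed.

End HilbertOperators.

(** * The maximum principle *)

Section ComplexTopology.
Variable R : realType.
Local Notation C := (R[i]).

Lemma rnormP (V : normedModType C) (x : V) (e : R) : (`|x| < e%:C%C) = (rnorm x < e).
Proof. by rewrite -rnormE ltcR. Qed.

Lemma posC (e : C) : 0 < e -> exists2 d : R, 0 < d & d%:C%C = e.
Proof.
move=> e0; have eE : (complex.Re e)%:C%C = e by rewrite RRe_real // gtr0_real.
by exists (complex.Re e) => //; rewrite -ltcR eE.
Qed.

Lemma cvg_rnormP (V : normedModType C) (T : Type) (F : set_system T) {FF : Filter F}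
    (f : T -> V) (l : V) :
  f x @[x --> F] --> l <-> forall e : R, 0 < e -> \forall x \near F, rnorm (f x - l) < e.
Proof.
split=> [/cvgrPdist_lt H e e0|H].
  have := H e%:C%C; rewrite ltcR => /(_ e0); apply: filterS => x.
  by rewrite rnormP rnormBC.
apply/cvgrPdist_lt => e /posC[d d0 <-]; have := H _ d0; apply: filterS => x.
by rewrite rnormP rnormBC.
Qed.

Lemma near_rnormP (z : C^o) (P : set C^o) :
  (\forall w \near z, P w) <-> exists2 e : R, 0 < e & forall w : C, rnorm (w - z) < e -> P w.
Proof.
split=> [/nbhs_normP[e /= /posC[d d0 <-] H]|[e e0 H]].
  by exists d => // w wz; apply: H => /=; rewrite rnormP rnormBC.
apply/nbhs_normP; exists e%:C%C => /=; first by rewrite ltcR.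
by move=> w /=; rewrite rnormP rnormBC; apply: H.
Qed.

Lemma ler_dist_rnorm (V : normedModType C) (x y : V) : `|rnorm x - rnorm y| <= rnorm (x - y).
Proof.
have h (a b : V) : rnorm a - rnorm b <= rnorm (a - b).
  by rewrite lerBlDr -{1}(subrK b a) rnormD.
by rewrite ler_norml h andbT lerNl opprB rnormBC h.
Qed.

Lemma rnorm_continuous (V : normedModType C) : continuous (@rnorm R V).
Proof.
move=> x; apply/cvgrPdist_lt => e e0.
have /cvg_rnormP/(_ e e0) : y @[y --> x] --> x by exact: cvg_id.
apply: filterS => y; rewrite rnormBC; apply: le_lt_trans; exact: ler_dist_rnorm.
Qed.

(** The disk is a closed subset of the continuous image of the square [[-1, 1]^2]. *)
Lemma closed_disk_compact : compact (@closed_disk R : set C^o).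
Proof.
pose toC (u : R * R) : C^o := (u.1 +i* u.2)%C.
have toC_cont : continuous toC.
  move=> u; apply/cvg_rnormP => e e0.
  have e2 : 0 < e / 2 by rewrite divr_gt0.
  have /cvgrPdist_lt/(_ _ e2) F1 : v.1 @[v --> u] --> u.1 by exact: cvg_fst.
  have /cvgrPdist_lt/(_ _ e2) F2 : v.2 @[v --> u] --> u.2 by exact: cvg_snd.
  apply: filterS2 F1 F2 => v h1 h2.
  have -> : toC v - toC u = (v.1 - u.1)%:C%C + 'i%C * (v.2 - u.2)%:C%C.
    exact: complexE.
  apply: le_lt_trans (rnormD _ _) _; rewrite rnormM.
  have rr (a : R) : rnorm (a%:C%C : C) = `|a|.
    by rewrite /rnorm normc_def /= expr0n addr0 sqrtr_sqr.
  have -> : rnorm ('i%C : C) = 1.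
    by rewrite /rnorm normc_def /= expr0n expr1n add0r sqrtr1.
  by rewrite !rr mul1r (splitr e) ltrD // distrC.
have box := continuous_compact (continuous_subspaceT toC_cont)
   (compact_setX (@segment_compact R (-1) 1) (@segment_compact R (-1) 1)).
apply: subclosed_compact box _.
  have -> : (@closed_disk R : set C^o) = @rnorm R C^o @^-1` [set x | x <= 1].
    by apply/seteqP; split => z; rewrite /closed_disk /= -rnormE lecR.
  apply: closed_comp => [z _|]; [exact: rnorm_continuous|exact: closed_le].
move=> z; rewrite /closed_disk /= => z1.
have hz : complex.Re z ^+ 2 + complex.Im z ^+ 2 <= 1.
  by rewrite -lecR add_Re2_Im2 exprn_ile1.
exists (complex.Re z, complex.Im z); last by case: z {z1 hz}.
split; rewrite /= in_itv /=; nra.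
Qed.

End ComplexTopology.

Section MaximumPrinciple.
Variable R : realType.
Local Notation C := (R[i]).

Definition continuous_on (V : normedZmodType C) (A : set C) (f : C -> V) : Prop :=
  forall z, A z -> forall e : R, 0 < e ->
    exists2 d : R, 0 < d & forall w, A w -> rnorm (w - z) < d -> rnorm (f w - f z) < e.

Lemma within_continuous_on (A : set C) (f : C -> C) :
  {within (A : set C^o), continuous (f : C^o -> C^o)} -> continuous_on A f.
Proof.
move=> /subspace_continuousP fc z Az e e0.
have /cvg_rnormP/(_ e e0)/near_rnormP := fc z Az.
by move => [d d0 H]; exists d => // w Aw wz; apply: H.
Qed.

(** Closedness of [A] is asked relative to the closed disk, so that it can be checked for level sets
    of functions known to be continuous on the disk only. *)
Lemma continuous_on_max (A : set C) (u : C -> R) :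
  (exists z, A z) -> (forall z, A z -> rnorm z <= 1) ->
  (forall z, rnorm z <= 1 -> ~ A z ->
     exists2 d : R, 0 < d & forall w, rnorm w <= 1 -> rnorm (w - z) < d -> ~ A w) ->
  (forall z, A z -> forall e : R, 0 < e ->
    exists2 d : R, 0 < d & forall w, A w -> rnorm (w - z) < d -> `|u w - u z| < e) ->
  exists2 z, A z & forall w, A w -> u w <= u z.
Proof.
move=> A0 A1 Acl uc.
have cA : compact (A : set C^o).
  apply: subclosed_compact (@closed_disk_compact R) _; last first.
    by move=> z /A1; rewrite /closed_disk /= -rnormE lecR.
  rewrite -[A : set C^o]setCK; apply: open_closedC; rewrite openE => z /= nAz.
  have [z1|z1] := leP (rnorm z) 1.
    have [d d0 H] := Acl z z1 nAz; apply/near_rnormP; exists d => // w wz Aw.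
    exact: H _ (A1 _ Aw) wz Aw.
  apply/near_rnormP; exists (rnorm z - 1); first by rewrite subr_gt0.
  move=> w wz /A1 w1; have := ler_dist_rnorm (V := C^o) w z.
  rewrite ler_norml => /andP[h _]; have := le_lt_trans (lexx _) wz => /= {}wz.
  have : - rnorm (w - z) <= rnorm w - rnorm z by [].
  by lra.
have [] := @compact_EVT_max (C^o) R u A _ cA.
- by case: A0 => z Az; exists z.
- apply/subspace_continuousP => z Az; apply/cvgrPdist_lt => e e0.
  have [d d0 H] := uc z Az e e0.
  by apply/near_rnormP; exists d => // w wz Aw; rewrite distrC; apply: H.
move=> z; rewrite inE => Az H; exists z => // w Aw; apply: H; by rewrite inE.
Qed.

(* Among the points where [|Q|] is maximal on the disk, one of largest modulus
   must lie on the circle. *)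
Lemma max_modulus (Q : C -> C) (B : R) :
  continuous_on [set z | rnorm z <= 1] Q ->
  (forall z0, rnorm z0 < 1 ->
     (exists2 d : R, 0 < d & forall w, rnorm (w - z0) < d -> rnorm (Q w) <= rnorm (Q z0)) ->
     exists2 d : R, 0 < d & forall w, rnorm (w - z0) < d -> Q w = Q z0) ->
  (forall z, rnorm z = 1 -> rnorm (Q z) <= B) ->
  forall z, rnorm z <= 1 -> rnorm (Q z) <= B.
Proof.
move=> Qc Qloc QB.
have Qc' (z : C) : rnorm z <= 1 -> forall e : R, 0 < e -> exists2 d : R, 0 < d &
    forall w, rnorm w <= 1 -> rnorm (w - z) < d -> `|rnorm (Q w) - rnorm (Q z)| < e.
  move=> z1 e e0; have [d d0 H] := Qc z z1 e e0; exists d => // w w1 wz.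
  exact: le_lt_trans (ler_dist_rnorm (V := C^o) _ _) (H w w1 wz).
have [z1 z1K z1max] : exists2 z : C, rnorm z <= 1 &
    forall w : C, rnorm w <= 1 -> rnorm (Q w) <= rnorm (Q z).
  apply: (@continuous_on_max [set z : C | rnorm z <= 1] (fun z => rnorm (Q z))) => //.
  by exists 0; rewrite /= rnorm0.
have [z2 [z2K z2Q] z2max] : exists2 z : C, rnorm z <= 1 /\ rnorm (Q z) = rnorm (Q z1) &
    forall w : C, rnorm w <= 1 /\ rnorm (Q w) = rnorm (Q z1) -> rnorm w <= rnorm z.
  apply: (@continuous_on_max
    [set z : C | rnorm z <= 1 /\ rnorm (Q z) = rnorm (Q z1)] (fun z => rnorm z)).
  - by exists z1.
  - by move=> z [].
  - move=> z z1' /not_andP[//|nQ].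
    have [|d d0 H] := Qc' z z1' `|rnorm (Q z) - rnorm (Q z1)|.
      by rewrite normr_gt0 subr_eq0; apply/eqP.
    by exists d => // w w1 wz [_ wQ]; have := H w w1 wz; rewrite wQ distrC ltxx.
  - move=> z _ e e0; exists e => // w _.
    by apply: le_lt_trans; exact: (ler_dist_rnorm (V := C^o)).
suff z2E : rnorm z2 = 1.
  by move=> z zK; apply: le_trans (z1max z zK) _; rewrite -z2Q; exact: QB.
apply/eqP; rewrite eq_le z2K leNgt; apply/negP => z2lt.
have [|d d0 Hd] := Qloc z2 z2lt.
  exists (1 - rnorm z2); first by rewrite subr_gt0.
  move=> w wz; rewrite z2Q; apply: z1max.
  by have := rnormD (w - z2) z2; rewrite subrK; lra.
(* The outward direction at [z2], arbitrary at the origin. Since [Q] is constant near [z2], a small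
   step along [u] yields a maximum point of larger modulus. *)
pose u : C := if z2 == 0 then 1 else z2 / `|z2|.
have uE : z2 = (rnorm z2)%:C%C * u.
  rewrite /u; case: eqP => [->|/eqP z20]; first by rewrite rnorm0 mul0r.
  by rewrite rnormE mulrC mulfVK // normr_eq0.
have u1 : rnorm u = 1.
  rewrite /u; case: eqP => [_|/eqP z20]; first exact: rnorm1.
  by apply/rnorm_eq1; rewrite normf_div normr_id divff // normr_eq0.
pose t := Num.min (d / 2) (1 - rnorm z2).
have t0 : 0 < t by rewrite lt_min divr_gt0 // subr_gt0 z2lt.
have td : t < d by rewrite gt_min ltr_pdivrMr // mulr_natr mulr2n ltrDl d0.
have tz : t <= 1 - rnorm z2 by rewrite ge_min lexx orbT.
pose w := z2 + t%:C%C * u.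
have wE : rnorm w = rnorm z2 + t.
  rewrite /w {1}uE -mulrDl -rmorphD rnormM u1 mulr1 rnorm_real //.
  by rewrite addr_ge0 ?rnorm_ge0 // ltW.
have : rnorm w <= rnorm z2.
  apply: z2max; rewrite wE; split; first by lra.
  by rewrite (Hd w) // /w addrC addKr rnormM u1 mulr1 rnorm_real // ltW.
by rewrite wE; lra.
Qed.

End MaximumPrinciple.

(** * Local power series expansions *)

Section PowerSeries.
Variable R : realType.
Local Notation C := (R[i]).
Implicit Types (f g : C -> C) (z h : C) (a b u v : nat -> C).

Definition sums_to u (l : C) : Prop := forall e : R, 0 < e ->
  exists N, forall n, (N <= n)%N -> rnorm (\sum_(k < n) u k - l) < e.

Definition expands f z a : Prop :=
  exists2 r : R, 0 < r & forall h : C, rnorm h < r ->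
    sums_to (fun n => a n * h ^+ n) (f (z + h)).

Lemma analytic_expands f z : analytic_at f z -> exists a, expands f z a.
Proof.
move=> [a [r [/posC[d d0 <-] H]]]; exists a; exists d => // h hd e e0.
have := H (z + h); rewrite [z + h - z]addrAC subrr add0r -rnormE ltcR => /(_ hd).
move=> /cvg_rnormP/(_ e e0) [N _ HN]; exists N => n Nn.
by have := HN n Nn; rewrite /= big_mkord.
Qed.

Lemma sums_toD u v (l m : C) : sums_to u l -> sums_to v m ->
  sums_to (fun n => u n + v n) (l + m).
Proof.
move=> ul vm e e0; have e2 : 0 < e / 2 by rewrite divr_gt0.
have [N HN] := ul _ e2; have [M HM] := vm _ e2.
exists (maxn N M) => n; rewrite geq_max => /andP[/HN h1 /HM h2].
rewrite big_split /= opprD addrACA (splitr e).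
exact: le_lt_trans (rnormD _ _) (ltrD h1 h2).
Qed.

Lemma sums_toZ u (l c : C) : sums_to u l -> sums_to (fun n => c * u n) (c * l).
Proof.
move=> ul e e0; have c1 : 0 < rnorm c + 1 by rewrite ltr_wpDl // rnorm_ge0.
have [|N HN] := ul (e / (rnorm c + 1)); first by rewrite divr_gt0.
exists N => n /HN; rewrite ltr_pdivlMr // => h.
rewrite -mulr_sumr -mulrBr rnormM; apply: le_lt_trans h.
by rewrite mulrC ler_wpM2l ?rnorm_ge0 // lerDl.
Qed.

Lemma eq_sums_to u v (l : C) : u =1 v -> sums_to u l -> sums_to v l.
Proof.
move=> uv ul e e0; have [N HN] := ul e e0; exists N => n Nn.
by under eq_bigr do rewrite -uv; exact: HN.
Qed.

Lemma sums_to_finite u N : (forall n, (N <= n)%N -> u n = 0) ->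
  sums_to u (\sum_(k < N) u k).
Proof.
move=> u0 e e0; exists N => n Nn.
rewrite (big_ord_widen n u Nn) [X in _ - X]big_mkcond -sumrB /= big1 ?rnorm0 // => k _.
by case: ltnP => [|/u0 ->]; rewrite subrr.
Qed.

Lemma sums_to_small u (l : C) (e : R) : sums_to u l -> 0 < e ->
  exists N, forall n, (N <= n)%N -> rnorm (u n) < e.
Proof.
move=> ul e0; have e2 : 0 < e / 2 by rewrite divr_gt0.
have [N HN] := ul _ e2; exists N => n Nn.
have h1 := HN _ Nn; have h2 := HN _ (leqW Nn).
have -> : u n = (\sum_(k < n.+1) u k - l) - (\sum_(k < n) u k - l).
  by rewrite big_ord_recr /=; ring.
rewrite (splitr e); exact: le_lt_trans (rnormB _ _) (ltrD h2 h1).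
Qed.

Lemma sums_to_bounded u (l : C) : sums_to u l ->
  exists2 K : R, 0 <= K & forall n, rnorm (u n) <= K.
Proof.
move=> /sums_to_small/(_ ltr01)[N HN].
have S0 : 0 <= \sum_(k < N) rnorm (u k) by apply: sumr_ge0 => k _; exact: rnorm_ge0.
exists (\sum_(k < N) rnorm (u k) + 1); first by rewrite addr_ge0.
move=> n; have [Nn|nN] := leqP N n; first by rewrite ler_wpDl // ltW // HN.
rewrite (bigD1 (Ordinal nN)) //= -addrA lerDl addr_ge0 //.
by apply: sumr_ge0 => k _; exact: rnorm_ge0.
Qed.

Lemma sums_to_le u (l c : C) (B : R) N : sums_to u l ->
  (forall n, (N <= n)%N -> rnorm (\sum_(k < n) u k - c) <= B) -> rnorm (l - c) <= B.
Proof.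
move=> ul H; apply/ler_addgt0Pl => e e0; have [M HM] := ul e e0.
pose n := maxn N M; have h1 := H n (leq_maxl _ _); have h2 := HM n (leq_maxr _ _).
rewrite (_ : l - c = (\sum_(k < n) u k - c) - (\sum_(k < n) u k - l)); last by ring.
by apply: le_trans (rnormB _ _) _; lra.
Qed.

Lemma sums_to_shift u (l : C) k : (forall n, (n < k)%N -> u n = 0) ->
  sums_to u l -> sums_to (fun n => u (n + k)%N) l.
Proof.
move=> u0 ul e e0; have [N HN] := ul e e0; exists N => n Nn.
have := HN (k + n)%N (leq_trans Nn (leq_addl _ _)).
rewrite big_split_ord /= big1 ?add0r; last by move=> i _; rewrite u0.
by under eq_bigr do rewrite addnC.
Qed.

Lemma expandsD f g z a b : expands f z a -> expands g z b ->
  expands (fun w => f w + g w) z (fun n => a n + b n).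
Proof.
move=> [r r0 fa] [s s0 gb]; exists (Num.min r s); first by rewrite lt_min r0.
move=> h; rewrite lt_min => /andP[hr hs].
apply: eq_sums_to (sums_toD (fa h hr) (gb h hs)) => n.
by rewrite mulrDl.
Qed.

Lemma expandsZ f z a (c : C) : expands f z a ->
  expands (fun w => c * f w) z (fun n => c * a n).
Proof.
move=> [r r0 fa]; exists r => // h hr.
by apply: eq_sums_to (sums_toZ c (fa h hr)) => n; rewrite mulrA.
Qed.

Lemma expands_ext f g z a : (forall w, f w = g w) -> expands f z a -> expands g z a.
Proof. by move=> fg [r r0 fa]; exists r => // h hr; rewrite -fg; exact: fa. Qed.

Lemma expands_poly (p : {poly C}) z :
  expands (fun w => p.[w]) z (fun n => (p \Po ('X + z%:P))`_n).
Proof.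
exists 1 => // h _.
have -> : p.[z + h] = (p \Po ('X + z%:P)).[h].
  by rewrite horner_comp hornerD hornerX hornerC addrC.
rewrite horner_coef; apply: sums_to_finite => n pn.
by rewrite nth_default ?mul0r.
Qed.

Lemma expands_rot f z (t : C) a : rnorm t = 1 -> expands f (t * z) a ->
  expands (fun w => f (t * w)) z (fun n => t ^+ n * a n).
Proof.
move=> t1 [r r0 fa]; exists r => // h hr; rewrite mulrDr.
have := fa (t * h); rewrite rnormM t1 mul1r => /(_ hr).
by apply: eq_sums_to => n; rewrite exprMn mulrCA mulrA.
Qed.

Lemma expands_sum (I : finType) (F : I -> C -> C) z (A : I -> nat -> C) :
  (forall i, expands (F i) z (A i)) ->
  expands (fun w => \sum_i F i w) z (fun n => \sum_i A i n).
Proof.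
move=> H.
have : forall s : seq I, expands (fun w => \sum_(i <- s) F i w) z
    (fun n => \sum_(i <- s) A i n).
  elim=> [|i s IH].
    exists 1 => // h _ e e0; exists 0 => n _.
    by rewrite [X in _ - X]big_nil subr0 big1 ?rnorm0 // => k _; rewrite big_nil mul0r.
  have [r r0 H1] := expandsD (H i) IH; exists r => // h hr; rewrite big_cons.
  by apply: eq_sums_to (H1 h hr) => n; rewrite big_cons.
move=> /(_ (enum I)) [r r0 H1]; exists r => // h hr.
by move: (H1 h hr); rewrite big_enum; apply: eq_sums_to => n; rewrite big_enum.
Qed.

(** The terms are bounded at the radius [s], where the series converges, so for [|h| < s / 2] the
    tail is dominated by a geometric series of ratio [1 / 2]. *)
Lemma expands_leading f z a m : expands f z a -> (forall n, (n < m)%N -> a n = 0) ->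
  exists K r : R, [/\ 0 <= K, 0 < r & forall h : C, rnorm h < r ->
    rnorm (f (z + h) - a m * h ^+ m) <= K * rnorm h ^+ m.+1].
Proof.
move=> [r r0 fa] a0; pose s := r / 2; have s0 : 0 < s by rewrite divr_gt0.
have sr : rnorm (s%:C%C : C) < r.
  by rewrite rnorm_real ?(ltW s0) // /s ltr_pdivrMr // mulr_natr mulr2n ltrDl.
have [K K0 HK] := sums_to_bounded (fa _ sr).
exists (2 * K / s ^+ m.+1), (s / 2); split.
- by rewrite divr_ge0 ?mulr_ge0 // exprn_ge0 // ltW.
- by rewrite divr_gt0.
move=> h hs; have hr : rnorm h < r.
  by apply: lt_trans hs _; rewrite /s; lra.
pose q := rnorm h / s.
have q0 : 0 <= q by rewrite divr_ge0 ?rnorm_ge0 ?(ltW s0).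
have q1 : q <= 2^-1 by rewrite ler_pdivrMr // mulrC ltW.
have an n : rnorm (a n * h ^+ n) <= K * q ^+ n.
  rewrite rnormM rnormX /q expr_div_n mulrA ler_pdivlMr ?exprn_gt0 //.
  rewrite mulrAC ler_wpM2r ?exprn_ge0 ?rnorm_ge0 //.
  by have := HK n; rewrite rnormM rnormX rnorm_real // ltW.
(* The factor [2 - 2 * 2^-1 ^+ j] is the partial sum of that geometric series, kept exact for the
   induction. *)
have bound j : rnorm (\sum_(k < m.+1 + j) a k * h ^+ k - a m * h ^+ m) <=
    K * q ^+ m.+1 * (2 - 2 * 2^-1 ^+ j).
  elim: j => [|j IH].
    rewrite addn0 big_ord_recr /= big1 ?add0r ?subrr ?rnorm0; last first.
      by move=> i _; rewrite a0 ?mul0r.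
    by rewrite expr0 mulr1 subrr mulr0.
  rewrite addnS big_ord_recr /= addrAC; apply: le_trans (rnormD _ _) _.
  have h1 : q ^+ j <= 2^-1 ^+ j by rewrite lerXn2r ?nnegrE // invr_ge0.
  have h2 := an (m.+1 + j)%N; rewrite [q ^+ _]exprD in h2.
  have h3 : 0 <= K * q ^+ m.+1 by rewrite mulr_ge0 ?exprn_ge0.
  have h4 : K * (q ^+ m.+1 * q ^+ j) <= K * q ^+ m.+1 * 2^-1 ^+ j.
    by rewrite mulrA ler_wpM2l.
  rewrite [2^-1 ^+ j.+1]exprS; move: h2 h4 IH; lra.
have -> : 2 * K / s ^+ m.+1 * rnorm h ^+ m.+1 = K * q ^+ m.+1 * 2.
  by rewrite /q [X in _ = _ * X * _]expr_div_n; move: (rnorm h ^+ m.+1) (s ^+ m.+1)^-1 => X Y; ring.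
apply: (sums_to_le (N := m.+1) (fa h hr)) => n mn.
rewrite -(subnKC mn); apply: le_trans (bound _) _.
rewrite ler_wpM2l ?mulr_ge0 ?exprn_ge0 // lerBlDr lerDl mulr_ge0 ?exprn_ge0 // invr_ge0 //.
Qed.

Lemma expands_at f z a : expands f z a -> f z = a 0.
Proof.
move=> fa; have [|K [r [K0 r0 H]]] := expands_leading (m := 0) fa; first by [].
have := H 0; rewrite rnorm0 => /(_ r0); rewrite addr0 expr0 mulr1 expr1 mulr0 => h.
by apply/eqP; rewrite -subr_eq0; apply/eqP; apply: rnorm_eq0; apply/eqP; rewrite eq_le h rnorm_ge0.
Qed.

Lemma expands_eq0 f z a : expands f z a -> (forall n, a n = 0) ->
  exists2 d : R, 0 < d & forall w : C, rnorm (w - z) < d -> f w = 0.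
Proof.
move=> [r r0 fa] a0; exists r => // w wr.
have := fa (w - z) wr; rewrite [z + _]addrC subrK => S.
apply: rnorm_eq0; apply/eqP; rewrite eq_le rnorm_ge0 andbT -[f w]subr0.
apply: (sums_to_le (N := 0) S) => n _.
by rewrite big1 ?subr0 ?rnorm0 // => k _; rewrite a0 mul0r.
Qed.

(** Dividing by [z ^+ k] shifts the coefficients; the value [a k] fills the removable
    singularity. *)
Lemma expands_quotient f a k : expands f 0 a -> (forall n, (n < k)%N -> a n = 0) ->
  expands (fun z => if z == 0 then a k else f z / z ^+ k) 0 (fun n => a (n + k)%N).
Proof.
move=> [r r0 fa] a0; exists r => // h hr; rewrite add0r.
have [->|h0] := eqVneq h 0.
  have -> : a k = \sum_(i < 1) a (i + k)%N * 0 ^+ i by rewrite big_ord1 mulr1.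
  by apply: sums_to_finite => n n1; rewrite expr0n gtn_eqF ?mulr0.
have := fa h hr; rewrite add0r => S.
have : sums_to (fun n => a (n + k)%N * h ^+ (n + k)) (f h).
  by apply: (sums_to_shift (u := fun n => a n * h ^+ n)) S => n nk; rewrite a0 // mul0r.
move=> /(sums_toZ (h ^- k)); rewrite [_ * f h]mulrC; apply: eq_sums_to => n.
by rewrite exprD mulrCA [h ^+ n * _]mulrC mulKf // expf_neq0.
Qed.

End PowerSeries.

(** * Local maxima of a quotient by a polynomial *)

Section LocalMaximum.
Variable R : realType.
Local Notation C := (R[i]).
Implicit Types (f : C -> C) (z : C).

Lemma horner_near (p : {poly C}) z : exists K r : R, [/\ 0 <= K, 0 < r &
  forall h : C, rnorm h < r -> rnorm (p.[z + h] - p.[z]) <= K * rnorm h].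
Proof.
have E := expands_poly p z.
have [|K [r [K0 r0 H]]] := expands_leading (m := 0) E; first by [].
exists K, r; split => // h hr; have := H h hr.
by rewrite -(expands_at E) expr0 mulr1 expr1.
Qed.

(* If [f / D - f z / D z] vanishes to the finite order [m] at [z], then moving
   in a direction where its leading term is a positive multiple of [f z / D z]
   makes [|f / D|] larger than at [z]. *)
Lemma local_max_quotient f (D : {poly C}) z a (d : R) : expands f z a -> D.[z] != 0 ->
  0 < d -> (forall w, rnorm (w - z) < d ->
    rnorm (f w) * rnorm D.[z] <= rnorm (f z) * rnorm D.[w]) ->
  exists2 e : R, 0 < e & forall w, rnorm (w - z) < e -> f w * D.[z] = f z * D.[w].
Proof.
move=> fa D0 d0 fD.
have nD0 : 0 < rnorm D.[z].
  by rewrite lt_def rnorm_ge0 andbT; apply: contra_neq D0; exact: rnorm_eq0.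
have [f0|f0] := eqVneq (f z) 0.
  exists d => // w wd; rewrite f0 mul0r; apply: rnorm_eq0; apply/eqP.
  by rewrite eq_le rnorm_ge0 andbT rnormM (le_trans (fD w wd)) // f0 rnorm0 mul0r.
pose c := f z / D.[z].
have c0 : 0 < rnorm c.
  rewrite lt_def rnorm_ge0 andbT; apply/eqP => /rnorm_eq0/eqP.
  by rewrite mulf_eq0 (negPf f0) invr_eq0 (negPf D0).
have cD : c * D.[z] = f z by rewrite mulfVK.
pose g w := f w + (- c) * D.[w].
pose b n := a n + (- c) * (D \Po ('X + z%:P))`_n.
have gb : expands g z b := expandsD fa (expandsZ (- c) (expands_poly D z)).
have g0 : g z = 0 by rewrite /g mulNr cD subrr.
have [b_eq0|] := pselect (forall n, b n = 0).
  have [e e0 ge] := expands_eq0 gb b_eq0; exists e => // w we.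
  have := ge w we; rewrite /g mulNr => /eqP; rewrite subr_eq0 => /eqP ->.
  by rewrite mulrAC cD.
move=> /existsNP[n0 /eqP bn0].
have [m bm bmin] := @ex_minnP (fun n => b n != 0) (ex_intro _ n0 bn0).
have bm0 n : (n < m)%N -> b n = 0.
  by move=> nm; apply/eqP; apply/negPn/negP => /bmin; rewrite leqNgt nm.
have m0 : (0 < m)%N.
  rewrite lt0n; apply/eqP => mE; move: bm; rewrite mE => /eqP; apply.
  by rewrite -(expands_at gb) -[LHS]/(g z) g0.
have [K [r [K0 r0 HK]]] := expands_leading gb bm0.
have [L [s [L0 s0 HL]]] := horner_near D z.
(* With [h = t k] the leading term [b m * h ^+ m] equals [t ^+ m * f z], pointing in the direction
   of [f z]. *)
pose k : C := m.-root (f z / b m).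
have km : b m * k ^+ m = f z by rewrite rootCK // mulrC mulfVK.
pose kn := rnorm k + 1.
have kn0 : 0 < kn by rewrite ltr_wpDl // rnorm_ge0.
pose A := K * kn ^+ m.+1 + rnorm c * L * kn + 1.
have A0 : 0 < A by rewrite ltr_wpDl // addr_ge0 ?mulr_ge0 ?exprn_ge0 ?rnorm_ge0 // ltW.
pose M := rnorm c * rnorm D.[z].
have M0 : 0 < M by rewrite mulr_gt0.
(* The first three bounds keep [h] within the radii of validity, and the last forces
   [2 t A <= M / 4], which contradicts [M <= 2 t A]. The final halving makes the inequalities
   strict. *)
pose t := Num.min (Num.min (d / kn) (Num.min (r / kn) (s / kn)))
  (Num.min 1 (M / (4 * A))) / 2.
have t0 : 0 < t by rewrite divr_gt0 // !lt_min !divr_gt0 // ?mulr_gt0 // ltr01.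
have t2 : t < 2 * t by lra.
have tmin : 2 * t <= Num.min (Num.min (d / kn) (Num.min (r / kn) (s / kn)))
    (Num.min 1 (M / (4 * A))).
  by rewrite /t mulrC divfK.
clearbody t; move: tmin; rewrite !le_min -!andbA => /and5P[td tr ts t1 tA].
have tk x : 2 * t <= x / kn -> t * kn < x.
  by move=> h; rewrite -ltr_pdivlMr //; exact: lt_le_trans t2 h.
pose h := t%:C%C * k.
have hn : rnorm h <= t * kn by rewrite rnormM rnorm_real ?(ltW t0) // ler_wpM2l ?(ltW t0) // lerDl.
have hd : rnorm h < d := le_lt_trans hn (tk _ td).
have hr : rnorm h < r := le_lt_trans hn (tk _ tr).
have hs : rnorm h < s := le_lt_trans hn (tk _ ts).
have E1 := HK h hr; have E2 := HL h hs.
have E3 := fD (z + h); rewrite addrAC subrr add0r in E3; have {}E3 := E3 hd.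
have bh : b m * h ^+ m = (t%:C)%C ^+ m * f z by rewrite exprMn mulrCA km.
have tm0 : 0 < t ^+ m by rewrite exprn_gt0.
have E4 : rnorm (f (z + h)) <= rnorm c * rnorm D.[z + h].
  rewrite -(ler_pM2r nD0); apply: le_trans E3 _.
  by rewrite -[in X in X <= _]cD rnormM; lra.
(* The remainder in the second line is of order [t ^+ m.+1], while maximality allows at most
   [|c| |D(z + h)|] on the left. Hence [t ^+ m |c| |D(z + h)|] is itself of order [t ^+ m.+1]. *)
have E5 : f (z + h) = (1 + (t%:C)%C ^+ m) * c * D.[z + h] +
   ((f (z + h) + (- c) * D.[z + h] - b m * h ^+ m) - (t%:C)%C ^+ m * c * (D.[z + h] - D.[z])).
  by rewrite bh -cD; ring.
pose X := rnorm D.[z + h].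
have E6 : (1 + t ^+ m) * rnorm c * X <=
    rnorm c * X + K * (t * kn) ^+ m.+1 + t ^+ m * rnorm c * (L * (t * kn)).
  have -> : (1 + t ^+ m) * rnorm c * X = rnorm ((1 + (t%:C)%C ^+ m) * c * D.[z + h]).
    rewrite !rnormM -rmorphXn -(rmorph1 (real_complex R)) -rmorphD /= rnorm_real //.
    by rewrite addr_ge0 // ltW.
  have -> : (1 + (t%:C)%C ^+ m) * c * D.[z + h] = f (z + h) -
     ((f (z + h) + (- c) * D.[z + h] - b m * h ^+ m) - (t%:C)%C ^+ m * c * (D.[z + h] - D.[z])).
    by rewrite {1}E5 addrK.
  apply: le_trans (rnormB _ _) _; rewrite -[leRHS]addrA; apply: lerD E4 _.
  apply: le_trans (rnormB _ _) _; apply: lerD.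
    apply: le_trans E1 _; rewrite ler_wpM2l // lerXn2r ?nnegrE ?rnorm_ge0 //.
    by rewrite mulr_ge0 // ltW.
  rewrite !rnormM rnormX rnorm_real ?(ltW t0) // ler_wpM2l ?mulr_ge0 ?rnorm_ge0 ?(ltW tm0) //.
  by apply: le_trans E2 _; rewrite ler_wpM2l.
have E7 : rnorm c * X <= t * (K * kn ^+ m.+1 + rnorm c * L * kn).
  rewrite -(ler_pM2l tm0).
  have -> : t ^+ m * (t * (K * kn ^+ m.+1 + rnorm c * L * kn)) =
     K * (t * kn) ^+ m.+1 + t ^+ m * rnorm c * (L * (t * kn)).
    rewrite exprMn [t ^+ m.+1]exprSr.
    by move: (kn ^+ m.+1) (t ^+ m) (rnorm c) => Y Z W; ring.
  by move: E6; lra.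
have E8 : rnorm D.[z] <= X + L * (t * kn).
  have := rnormB D.[z + h] (D.[z + h] - D.[z]); rewrite opprB addrC subrK => e8.
  by apply: le_trans e8 _; rewrite lerD2l; apply: le_trans E2 _; rewrite ler_wpM2l.
have E9 : M <= 2 * t * A.
  apply: (@le_trans _ _ (rnorm c * X + t * (rnorm c * L * kn))).
    by rewrite /M; apply: le_trans (ler_wpM2l (ltW c0) E8) _; lra.
  have : 0 <= t * (K * kn ^+ m.+1).
    by rewrite mulr_ge0 ?(ltW t0) // mulr_ge0 // exprn_ge0 // ltW.
  by rewrite /A; move: E7 t0; lra.
have : 2 * t * A <= M / 4.
  by move: tA; rewrite ler_pdivlMr ?mulr_gt0 //; lra.
by move: E9 M0; lra.
Qed.

End LocalMaximum.

(** * The disk algebra *)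

Section DiskFunctions.
Variable R : realType.
Local Notation C := (R[i]).
Local Notation D1 := [set z : C | rnorm z <= 1].
Implicit Types (f g : C -> C) (z : C).

(** What the proof uses of [disk_algebra], with real radii and epsilon-delta continuity. *)
Definition disk_fun f : Prop :=
  continuous_on D1 f /\ forall z, rnorm z < 1 -> exists a, expands f z a.

Lemma continuous_onP (A : set C) f : continuous_on A f <->
  forall z, A z -> (f : C -> C^o) @ within A (nbhs (z : C^o)) --> (f z : C^o).
Proof.
split=> [fc z Az|fc z Az e e0].
  apply/cvg_rnormP => e e0; have [d d0 H] := fc z Az e e0.
  by apply/near_rnormP; exists d => // w wz Aw; apply: H.
have /cvg_rnormP/(_ e e0)/near_rnormP[d d0 H] := fc z Az.
by exists d => // w Aw wz; apply: H.
Qed.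

Lemma disk_algebra_fun f : disk_algebra f -> disk_fun f.
Proof.
move=> [fc fa]; split; last first.
  by move=> z z1; apply: analytic_expands; apply: fa; rewrite /open_disk /= -rnormE ltcR.
have -> : D1 = @closed_disk R by apply/seteqP; split=> z; rewrite /closed_disk /= -rnormE lecR.
exact: within_continuous_on.
Qed.

Lemma continuous_onD (A : set C) f g : continuous_on A f -> continuous_on A g ->
  continuous_on A (fun z => f z + g z).
Proof.
move=> /continuous_onP fc /continuous_onP gc; apply/continuous_onP => z Az.
by apply: cvgD; [exact: fc|exact: gc].
Qed.

Lemma continuous_onM (A : set C) f g : continuous_on A f -> continuous_on A g ->
  continuous_on A (fun z => f z * g z).
Proof.
move=> /continuous_onP fc /continuous_onP gc; apply/continuous_onP => z Az.
by apply: cvgM; [exact: fc|exact: gc].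
Qed.

Lemma continuous_onV (A : set C) f : continuous_on A f -> (forall z, A z -> f z != 0) ->
  continuous_on A (fun z => (f z)^-1).
Proof.
move=> /continuous_onP fc f0; apply/continuous_onP => z Az.
by apply: cvgV; [exact: f0|exact: fc].
Qed.

Lemma continuous_on_poly (A : set C) (p : {poly C}) : continuous_on A (horner p).
Proof.
move=> z _ e e0; have [K [r [K0 r0 H]]] := horner_near p z.
have K1 : 0 < K + 1 by rewrite ltr_wpDl.
exists (Num.min r (e / (K + 1))); first by rewrite lt_min r0 divr_gt0.
move=> w _; rewrite lt_min ltr_pdivlMr // => /andP[wr we].
have := H (w - z) wr; rewrite [z + _]addrC subrK => /le_lt_trans; apply.
by apply: le_lt_trans we; rewrite mulrC ler_wpM2l ?rnorm_ge0 // lerDl.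
Qed.

Lemma disk_funD f g : disk_fun f -> disk_fun g -> disk_fun (fun z => f z + g z).
Proof.
move=> [fc fa] [gc ga]; split; first exact: continuous_onD.
move=> z z1; have [a Ha] := fa z z1; have [b Hb] := ga z z1.
by eexists; exact: expandsD Ha Hb.
Qed.

Lemma disk_fun_poly (p : {poly C}) : disk_fun (horner p).
Proof. by split; [exact: continuous_on_poly|move=> z _; eexists; exact: expands_poly]. Qed.

Lemma disk_funZ (c : C) f : disk_fun f -> disk_fun (fun z => c * f z).
Proof.
move=> [fc fa]; split.
  apply: continuous_onM fc => z _ e e0; exists 1 => // w _ _.
  by rewrite subrr rnorm0.
by move=> z z1; have [a Ha] := fa z z1; eexists; exact: expandsZ Ha.
Qed.

Lemma disk_fun_rot (t : C) f : rnorm t = 1 -> disk_fun f -> disk_fun (fun z => f (t * z)).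
Proof.
move=> t1 [fc fa]; split=> [z z1 e e0|z z1].
  have [|d d0 H] := fc (t * z) _ e e0; first by rewrite /= rnormM t1 mul1r.
  exists d => // w w1 wz; apply: H; first by rewrite /= rnormM t1 mul1r.
  by rewrite -mulrBr rnormM t1 mul1r.
have [|a Ha] := fa (t * z); first by rewrite rnormM t1 mul1r.
by eexists; exact: expands_rot Ha.
Qed.

Lemma disk_fun_sum (s : seq nat) (F : nat -> C -> C) :
  (forall i, disk_fun (F i)) -> disk_fun (fun z => \sum_(i <- s) F i z).
Proof.
move=> H; elim: s => [|i s IH].
  have [hc ha] := disk_fun_poly 0; split.
    by move=> z z1 e e0; exists 1 => // w _ _; rewrite !big_nil subrr rnorm0.
  move=> z z1; have [a Ha] := ha z z1; exists a; apply: expands_ext Ha => w.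
  by rewrite horner0 big_nil.
have [hc ha] := disk_funD (H i) IH; split.
  move=> z z1 e e0; have [d d0 Hd] := hc z z1 e e0; exists d => // w w1 wz.
  by rewrite !big_cons; exact: Hd.
move=> z z1; have [a Ha] := ha z z1; exists a; apply: expands_ext Ha => w.
by rewrite big_cons.
Qed.

Lemma disk_fun_bounded f : disk_fun f ->
  exists2 B : R, 0 <= B & forall z, rnorm z <= 1 -> rnorm (f z) <= B.
Proof.
move=> [fc _].
have [] := @continuous_on_max R D1 (fun z => rnorm (f z)).
- by exists 0; rewrite /= rnorm0.
- by [].
- by move=> z z1 /(_ z1).
- move=> z z1 e e0; have [d d0 H] := fc z z1 e e0; exists d => // w w1 wz.
  exact: le_lt_trans (ler_dist_rnorm (V := C^o) _ _) (H w w1 wz).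
by move=> z z1 H; exists (rnorm (f z)) => //; exact: rnorm_ge0.
Qed.

(** [max_modulus] for [f / p]. Its local condition comes from [local_max_quotient], which compares
    [f] with a multiple of [p] and so avoids expanding the quotient in a power series. *)
Lemma quotient_max_modulus f (p : {poly C}) (B : R) : disk_fun f ->
  (forall z, rnorm z <= 1 -> p.[z] != 0) ->
  (forall z, rnorm z = 1 -> rnorm (f z) <= B * rnorm p.[z]) ->
  forall z, rnorm z <= 1 -> rnorm (f z) <= B * rnorm p.[z].
Proof.
move=> [fc fa] p0 fB z z1.
have pn w : rnorm w <= 1 -> 0 < rnorm p.[w].
  move=> /p0 pw; rewrite lt_def rnorm_ge0 andbT; apply: contra_neq pw; exact: rnorm_eq0.
rewrite -ler_pdivrMr ?pn // -rnormV -rnormM.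
apply: (@max_modulus R (fun z => f z / p.[z])) => //.
- by apply: continuous_onM fc _; apply: continuous_onV => //; exact: continuous_on_poly.
- move=> z0 z01 [d d0 H]; have [a Ha] := fa z0 z01.
  pose e := Num.min d (1 - rnorm z0).
  have e0 : 0 < e by rewrite lt_min d0 subr_gt0.
  have w1 w : rnorm (w - z0) < e -> rnorm w <= 1.
    rewrite lt_min => /andP[_ h]; have := rnormD (w - z0) z0; rewrite subrK; lra.
  have [|e' e'0 He'] := local_max_quotient Ha (p0 _ (ltW z01)) e0.
    move=> w we; have := H w; rewrite !rnormM !rnormV => h.
    have {}h : rnorm (f w) / rnorm p.[w] <= rnorm (f z0) / rnorm p.[z0].
      by apply: h; move: we; rewrite lt_min => /andP[].
    move: h; rewrite ler_pdivrMr ?pn ?(w1 w we) // mulrAC.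
    by rewrite ler_pdivlMr ?pn ?(ltW z01).
  exists (Num.min e e'); first by rewrite lt_min e0.
  move=> w; rewrite lt_min => /andP[/w1/p0 pw /He' fw].
  apply: (mulIf pw); apply: (mulIf (p0 _ (ltW z01))).
  by rewrite divfK // fw mulrAC divfK // p0 // ltW.
by move=> w w1; rewrite rnormM rnormV ler_pdivrMr ?pn ?w1 //; exact: fB.
Qed.

(** The maximum principle for [f z / z ^+ k], with its removable singularity filled by [a k]; on the
    circle it has the same modulus as [f]. *)
Lemma schwarz f a k (B : R) : disk_fun f -> expands f 0 a ->
  (forall n, (n < k)%N -> a n = 0) ->
  (forall z, rnorm z = 1 -> rnorm (f z) <= B) ->
  rnorm (a k) <= B /\ forall z, rnorm z <= 1 -> rnorm (f z) <= B * rnorm z ^+ k.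
Proof.
move=> [fc fa] Ha a0 fB.
pose Q z := if z == 0 then a k else f z / z ^+ k.
have Qa := expands_quotient Ha a0; rewrite -/Q in Qa.
have Q0 : Q 0 = a k by rewrite /Q eqxx.
have QE z : z != 0 -> Q z = f z / z ^+ k by rewrite /Q => /negPf ->.
have near0 z w : rnorm (w - z) < rnorm z -> w != 0.
  by move=> h; apply/eqP => w0; move: h; rewrite w0 sub0r rnormN ltxx.
have rp z : z != 0 -> 0 < rnorm z.
  by move=> z0; rewrite lt_def rnorm_ge0 andbT; apply: contra_neq z0; exact: rnorm_eq0.
have QB z : rnorm z <= 1 -> rnorm (Q z) <= B.
  apply: max_modulus.
  - move=> z0 z01 e e0; have [->|z0n] := eqVneq z0 0.
      have [|K [r [K0 r0 H]]] := expands_leading (m := 0) Qa; first by [].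
      have K1 : 0 < K + 1 by rewrite ltr_wpDl.
      exists (Num.min r (e / (K + 1))); first by rewrite lt_min r0 divr_gt0.
      move=> w _; rewrite subr0 lt_min ltr_pdivlMr // => /andP[/H].
      rewrite add0r expr0 mulr1 expr1 add0n Q0 => h we; apply: le_lt_trans h _.
      by apply: le_lt_trans we; rewrite mulrC ler_wpM2l ?rnorm_ge0 // lerDl.
    have Qc : continuous_on ([set z | rnorm z <= 1] `\ (0 : C)) (fun z => f z / ('X^k).[z]).
      apply: continuous_onM.
        move=> u [u1 _] e' e'0; have [d d0 H] := fc u u1 e' e'0.
        by exists d => // w [w1 _]; exact: H.
      apply: continuous_onV; first exact: continuous_on_poly.
      by move=> u [_ /eqP u0]; rewrite hornerXn expf_neq0.
    have [|d d0 H] := Qc z0 _ e e0; first by split=> //; exact/eqP.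
    exists (Num.min d (rnorm z0)); first by rewrite lt_min d0 rp.
    move=> w w1; rewrite lt_min => /andP[wd /near0 w0].
    have := H w; rewrite !hornerXn !QE //; apply => //.
    by split=> //; exact/eqP.
  - move=> z0 z01 [d d0 H]; have [z0E|z0n] := eqVneq z0 0.
      (* At the origin [Q] has its own expansion and the denominator is 1; at the other points [Q]
         is treated as the quotient of [f] by ['X^k]. *)
      rewrite z0E in H *; have [||e e0 He] := @local_max_quotient R Q 1 0 _ d Qa _ d0.
      + by rewrite hornerC oner_neq0.
      + by move=> w /H; rewrite !hornerC rnorm1 !mulr1.
      by exists e => // w /He; rewrite !hornerC !mulr1.
    have [b Hb] := fa z0 z01.
    have e0 : 0 < Num.min d (rnorm z0) by rewrite lt_min d0 rp.
    have zk : ('X^k).[z0] != 0 by rewrite hornerXn expf_neq0.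
    have [|e' e'0 He] := local_max_quotient Hb zk e0.
      move=> w; rewrite lt_min => /andP[/H h /near0 w0]; move: h.
      rewrite !QE // !rnormM !rnormV !hornerXn !rnormX.
      by rewrite ler_pdivrMr ?exprn_gt0 ?rp // mulrAC ler_pdivlMr ?exprn_gt0 ?rp.
    exists (Num.min e' (rnorm z0)); first by rewrite lt_min e'0 rp.
    move=> w; rewrite lt_min => /andP[/He + /near0 w0]; rewrite !hornerXn => h.
    rewrite !QE //; apply: (mulIf (expf_neq0 k w0)); apply: (mulIf (expf_neq0 k z0n)).
    by rewrite divfK ?expf_neq0 // h mulrAC divfK // expf_neq0.
  move=> u u1; have u0 : u != 0 by apply: contra_eq_neq u1 => ->; rewrite rnorm0 eq_sym oner_neq0.
  by rewrite QE // rnormM rnormV rnormX u1 expr1n invr1 mulr1 fB.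
split; first by rewrite -Q0 QB // rnorm0.
move=> z z1; have [->|z0] := eqVneq z 0.
  rewrite (expands_at Ha) rnorm0 expr0n; case: eqP => [k0|/eqP k0].
    by have := QB 0; rewrite Q0 k0 rnorm0 mulr1; apply.
  by rewrite a0 ?lt0n // rnorm0 mulr0.
by have := QB z z1; rewrite QE // rnormM rnormV rnormX ler_pdivrMr ?exprn_gt0 ?rp.
Qed.

End DiskFunctions.

Section DiskAlgebra.
Variable R : realType.
Local Notation C := (R[i]).
Implicit Types (f : C -> C).

(* Averaging [f (w^i z)] against the character [w^(-ik)], for [w] a primitive
   root of unity of order [k + 1], kills the coefficients of index less than [k]. *)
Lemma cauchy_estimate f a (B : R) k : disk_fun f -> expands f 0 a ->
  (forall z, rnorm z = 1 -> rnorm (f z) <= B) -> rnorm (a k) <= B.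
Proof.
move=> ff Ha fB; have [w wP] := prim_root_exists C (ltn0Sn k).
have w1 i : rnorm (w ^+ i) = 1 by apply/rnorm_eq1; exact: prim_root_norm wP.
pose c i : C := (w ^+ i) ^- k / k.+1%:R.
pose F i z := c i * f (w ^+ i * z).
pose h z := \sum_(i <- iota 0 k.+1) F i z.
have hh : disk_fun h.
  by apply: disk_fun_sum => i; apply: disk_funZ; exact: disk_fun_rot.
pose b n := \sum_(i < k.+1) c i * ((w ^+ i) ^+ n * a n).
have hb : expands h 0 b.
  have : expands (fun z => \sum_(i < k.+1) F i z) 0 b.
    apply: expands_sum => i; apply: expandsZ; apply: expands_rot => //.
    by rewrite mulr0.
  by apply: expands_ext => z; rewrite /h -(big_mkord xpredT (fun i => F i z)) /index_iota subn0.
(* Indices above [k] may alias and survive; [schwarz] asks for vanishing below [k] only. *)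
have bE n : (n < k.+1)%N -> b n = (n == k)%:R * a n.
  move=> nk; transitivity ((\sum_(i < k.+1) (w ^+ i) ^+ n * (w ^+ i) ^- k) * (a n / k.+1%:R)).
    by rewrite mulr_suml; apply: eq_bigr => i _; rewrite /c; ring.
  have nz : k.+1%:R != 0 :> C by rewrite pnatr_eq0.
  by rewrite prim_root_ortho // natrM mulrA mulrC !mulrA mulVf // mul1r.
have [|//|hk _] := schwarz hh hb (k := k) (B := B).
- by move=> n nk; rewrite bE ?ltnS ?(ltnW nk) // ltn_eqF // mul0r.
- move=> z z1; apply: le_trans (rnorm_sum _ _ _) _.
  apply: (@le_trans _ _ (\sum_(i <- iota 0 k.+1) (B / k.+1%:R))).
    apply: ler_sum => i _; have -> : B / k.+1%:R = rnorm (c i) * B.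
      rewrite /c rnormM !rnormV [rnorm (_ ^+ k)]rnormX w1 expr1n invr1 mul1r mulrC.
      by rewrite -(rmorph_nat (real_complex R)) rnorm_real.
    by rewrite /F rnormM ler_wpM2l ?rnorm_ge0 // fB // rnormM w1 mul1r.
  rewrite big_const_seq count_predT size_iota iter_addr_0 -[leLHS]mulr_natr divfK //.
by move: hk; rewrite bE // eqxx mul1r.
Qed.

(** The remainder vanishes to order [N] at 0, and on the circle it is bounded by [B] for [f] plus
    [B] for each of the [N] Taylor terms, so [schwarz] applies. The factor [N.+1] is harmless
    against [r ^+ N]. *)
Lemma taylor_remainder f a (B : R) N : disk_fun f -> expands f 0 a ->
  (forall z, rnorm z = 1 -> rnorm (f z) <= B) ->
  forall z, rnorm z <= 1 ->
    rnorm (f z - (\poly_(i < N) a i).[z]) <= N.+1%:R * B * rnorm z ^+ N.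
Proof.
move=> ff Ha fB z z1; set p := \poly_(i < N) a i.
have gg : disk_fun (fun z => f z + (- p).[z]) by apply: disk_funD ff (disk_fun_poly _).
have Hb := expandsD Ha (expands_poly (- p) 0).
have [||_ /(_ z z1)] := schwarz gg Hb (k := N) (B := N.+1%:R * B).
- move=> n nN; rewrite addr0 comp_polyXr coefN coef_poly nN subrr //.
- move=> u u1; apply: le_trans (rnormD _ _) _.
  rewrite -natr1 mulrDl mul1r addrC; apply: lerD; last exact: fB.
  rewrite hornerN rnormN horner_poly; apply: le_trans (rnorm_sum _ _ _) _.
  apply: (@le_trans _ _ (\sum_(i < N) B)).
    apply: ler_sum => i _; rewrite rnormM rnormX u1 expr1n mulr1.
    exact: cauchy_estimate Ha fB.
  by rewrite sumr_const card_ord mulr_natl.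
by rewrite hornerN.
Qed.

(** Write [r = s * s]. One factor [s ^+ N] absorbs [N.+1], since [N.+1 s^N] is at most the geometric
    sum, and the other tends to 0. *)
Lemma natM_exp_small (r B e : R) : 0 <= r -> r < 1 -> 0 <= B -> 0 < e ->
  exists N, N.+1%:R * B * r ^+ N <= e.
Proof.
move=> r0 r1 B0 e0; pose s := Num.sqrt r.
have s0 : 0 <= s := sqrtr_ge0 r.
have rs : r = s * s by rewrite -expr2 sqr_sqrtr.
have s1 : s < 1 by rewrite -sqrtr1 ltr_sqrt.
have Ns N : N.+1%:R * s ^+ N <= (1 - s)^-1.
  rewrite -[leRHS]mul1r ler_pdivlMr ?subr_gt0 // mulrC.
  apply: (@le_trans _ _ ((1 - s) * \sum_(i < N.+1) s ^+ i)).
    rewrite ler_wpM2l ?subr_ge0 ?(ltW s1) //.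
    rewrite -[N.+1 in leLHS]card_ord mulr_natl -sumr_const; apply: ler_sum => i _.
    by rewrite ler_wiXn2l ?(ltW s1) // -ltnS.
  rewrite -opprB mulNr -subrX1 opprB lerBlDr lerDl exprn_ge0 //.
have e1 : 0 < e * (1 - s) / (B + 1) by rewrite divr_gt0 ?mulr_gt0 ?subr_gt0 // ltr_wpDl.
have sn : `|s| < 1 by rewrite ger0_norm.
have /cvgrPdist_lt/(_ _ e1)[N _ HN] := cvg_expr sn.
exists N; have := HN N (leqnn N); rewrite /= sub0r normrN ger0_norm ?exprn_ge0 // => h.
rewrite rs exprMn (_ : _ * _ = N.+1%:R * s ^+ N * (B * s ^+ N)); last by ring.
apply: le_trans (ler_wpM2r _ (Ns N)) _; first by rewrite mulr_ge0 ?exprn_ge0.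
rewrite mulrC ler_pdivrMr ?subr_gt0 //.
apply: (@le_trans _ _ ((B + 1) * s ^+ N)); first by rewrite ler_wpM2r ?exprn_ge0 // lerDl.
by rewrite mulrC -ler_pdivlMr ?ltr_wpDl // ltW.
Qed.

(** Uniform continuity in the radial direction: compactness, in its near-covering form, yields one
    radius [1 - 1 / (N + 1)] valid for all points of the disk. *)
Lemma disk_fun_radial f (e : R) : disk_fun f -> 0 < e -> exists2 r : R, 0 <= r < 1 &
  forall z, rnorm z <= 1 -> rnorm (f z - f (r%:C%C * z)) <= e.
Proof.
move=> [fc _] e0.
pose P (n : nat) (z : C^o) := rnorm z <= 1 ->
  rnorm (f z - f ((1 - n.+1%:R^-1)%:C%C * z)) <= e.
have := @closed_disk_compact R; rewrite compact_near_coveringP.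
move=> /(_ nat \oo P _)[].
  move=> x; rewrite /closed_disk /= -rnormE lecR => x1.
  have e2 : 0 < e / 2 by rewrite divr_gt0.
  have [d d0 Hd] := fc x x1 _ e2.
  have d2 : 0 < d / 2 by rewrite divr_gt0.
  exists ([set z : C^o | rnorm (z - x) < d / 2], [set n | n.+1%:R^-1 < d / 2]); last first.
    move=> [z n] [/= zx nd] z1.
    have n1 : 0 <= 1 - n.+1%:R^-1 :> R by rewrite subr_ge0 invf_le1 // ler1n.
    have rn : rnorm ((1 - n.+1%:R^-1)%:C%C * z - z) <= n.+1%:R^-1.
      rewrite rmorphB rmorph1 mulrBl mul1r addrAC subrr add0r rnormN rnormM.
      by rewrite rnorm_real ?invr_ge0 // ler_piMr ?invr_ge0.
    rewrite (_ : f z - _ = (f z - f x) - (f ((1 - n.+1%:R^-1)%:C%C * z) - f x)); last by ring.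
    apply: le_trans (rnormB _ _) _; rewrite (splitr e); apply: ltW; apply: ltrD.
      by apply: Hd => //; apply: lt_trans zx _; rewrite ltr_pdivrMr // mulr_natr mulr2n ltrDl.
    apply: Hd.
      rewrite /= rnormM rnorm_real //; apply: mulr_ile1 => //; first exact: rnorm_ge0.
    rewrite (_ : _ - x = ((1 - n.+1%:R^-1)%:C%C * z - z) + (z - x)); last by ring.
    apply: le_lt_trans (rnormD _ _) _; rewrite (splitr d).
    exact: ler_ltD (le_trans rn (ltW nd)) zx.
  split; first by apply/near_rnormP; exists (d / 2).
  near=> n => /=.
  by near: n; exact: near_infty_natSinv_lt (PosNum d2).
move=> N _ HN; exists (1 - N.+1%:R^-1).
  by rewrite subr_ge0 invf_le1 // ler1n //= ltrBlDr ltrDl invr_gt0.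
move=> z z1; apply: (HN N (leqnn N) z) => //.
by rewrite /closed_disk /= -rnormE lecR.
Unshelve. all: by end_near. Qed.

(** A dilate of [f] is uniformly close to [f], and the Taylor polynomials of a dilate converge
    geometrically on the closed disk. *)
Lemma disk_fun_density f (e : R) : disk_fun f -> 0 < e ->
  exists p : {poly C}, forall z, rnorm z <= 1 -> rnorm (p.[z] - f z) <= e.
Proof.
move=> ff e0; have e2 : 0 < e / 2 by rewrite divr_gt0.
have [r /andP[r0 r1] Hr] := disk_fun_radial ff e2.
have [B B0 HB] := disk_fun_bounded ff.
have [a Ha] : exists a, expands f 0 a by case: ff => _; apply; rewrite rnorm0.
have [N HN] := natM_exp_small r0 r1 B0 e2.
exists ((\poly_(i < N) a i) \Po (r%:C%C *: 'X)) => z z1; rewrite horner_scale.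
have rz : rnorm (r%:C%C * z) <= r by rewrite rnormM rnorm_real // ler_piMr.
have h1 : rnorm (f (r%:C%C * z) - (\poly_(i < N) a i).[r%:C%C * z]) <= e / 2.
  apply: le_trans HN; apply: le_trans (taylor_remainder N ff Ha _ _) _.
  - by move=> u u1; apply: HB; rewrite u1.
  - by apply: le_trans rz (ltW r1).
  by rewrite ler_wpM2l ?mulr_ge0 // lerXn2r ?nnegrE ?rnorm_ge0.
have h2 := Hr z z1; rewrite rnormBC.
rewrite (_ : f z - _ = (f z - f (r%:C%C * z)) +
  (f (r%:C%C * z) - (\poly_(i < N) a i).[r%:C%C * z])); last by ring.
by apply: le_trans (rnormD _ _) _; rewrite (splitr e) lerD.
Qed.

(** Subadditivity gives [w (n d) <= n w d]; take [n] to be one more than the integer part of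
    [t / d]. *)
Lemma modulus_dilation (w : R -> R) (t d : R) : modulus_of_continuity w -> 0 <= t -> 0 < d ->
  w t <= (1 + t / d) * w d.
Proof.
move=> [mono _ w0 wpos wsub] t0 d0.
have wn n : w (n%:R * d) <= n%:R * w d.
  elim: n => [|n IH]; first by rewrite !mul0r w0.
  rewrite -natr1 !mulrDl !mul1r.
  apply: le_trans (wsub _ _ _ (ltW d0)) _; first by rewrite mulr_ge0 // ltW.
  by rewrite lerD2r.
have td : 0 <= t / d by rewrite divr_ge0 // ltW.
have /andP[h1 h2] := truncn_itv td.
apply: le_trans (_ : w t <= w ((Num.truncn (t / d)).+1%:R * d)) _.
  apply: mono; rewrite ?in_itv /= ?andbT // ?mulr_ge0 ?(ltW d0) //.
  by rewrite -ler_pdivrMr // ltW.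
apply: le_trans (wn _) _; rewrite ler_wpM2r //; first exact: ltW (wpos _ d0).
by rewrite -natr1 addrC lerD2l.
Qed.

(* The maximum principle applied to [(f z - f zeta) / (1 + d - zeta^* z)]: on
   the circle the denominator dominates both [d] and [|z - zeta|] up to constants. *)
Lemma hardy_littlewood f (w : R -> R) (L r : R) (zeta : C) :
  disk_fun f -> modulus_of_continuity w -> 0 <= L ->
  (forall z u : C, rnorm z = 1 -> rnorm u = 1 -> rnorm (f z - f u) <= L * w (rnorm (z - u))) ->
  rnorm zeta = 1 -> 0 <= r -> r <= 1 ->
  rnorm (f zeta - f (r%:C%C * zeta)) <= 6 * L * w (1 - r).
Proof.
move=> ff wmod L0 fL zeta1 r0 r1; have [mono _ w0 wpos wsub] := wmod.
have [->|rn1] := eqVneq r 1.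
  by rewrite rmorph1 mul1r subrr subrr w0 mulr0 rnorm0.
pose d := 1 - r; have d0 : 0 < d by rewrite subr_gt0 lt_neqAle rn1.
have zz : zeta^* * zeta = 1.
  by rewrite mulrC -normCK (proj1 (rnorm_eq1 _) zeta1) expr1n.
have zc1 : rnorm zeta^* = 1.
  by apply/rnorm_eq1; rewrite norm_conjC; apply/rnorm_eq1.
pose p : {poly C} := (1 + d)%:C%C%:P - zeta^* *: 'X.
have pE z : p.[z] = (1 + d)%:C%C - zeta^* * z by rewrite /p !hornerE.
have d1 : rnorm (1 + d)%:C%C = 1 + d by rewrite rnorm_real // addr_ge0 // ltW.
have pd z : rnorm z <= 1 -> d <= rnorm p.[z].
  move=> z1; have := rnormD p.[z] (zeta^* * z); rewrite pE subrK d1 rnormM zc1 mul1r.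
  by move: z1; lra.
have gg : disk_fun (fun z => f z + (- (f zeta)%:P).[z]).
  by apply: disk_funD ff (disk_fun_poly _).
have p0 z : rnorm z <= 1 -> p.[z] != 0.
  by move=> /pd h; apply: contraTneq h => ->; rewrite rnorm0 -ltNge.
have wd0 : 0 < w d := wpos _ d0.
(* From [|z - zeta| <= |p(z)| + d] and [d <= |p(z)|] one gets [1 + |z - zeta| / d <= 3 |p(z)| / d],
   whence the factor 3. *)
have bound z : rnorm z = 1 -> rnorm (f z + (- (f zeta)%:P).[z]) <= 3 * L * w d / d * rnorm p.[z].
  move=> z1; rewrite hornerN hornerC.
  apply: le_trans (fL _ _ z1 zeta1) _.
  have t_le : rnorm (z - zeta) <= rnorm p.[z] + d.
    have -> : rnorm (z - zeta) = rnorm (p.[z] - d%:C%C).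
      have -> : p.[z] - d%:C%C = - (zeta^* * (z - zeta)).
        by rewrite pE rmorphD rmorph1 /= mulrBr zz; ring.
      by rewrite rnormN rnormM zc1 mul1r.
    by apply: le_trans (rnormB _ _) _; rewrite (rnorm_real (ltW d0)).
  have dp := pd z; rewrite z1 lexx in dp; have {}dp := dp isT.
  apply: le_trans (ler_wpM2l L0 (modulus_dilation wmod (rnorm_ge0 _) d0)) _.
  rewrite (_ : 3 * L * w d / d * rnorm p.[z] = L * (3 * rnorm p.[z] / d * w d)); last by ring.
  rewrite ler_wpM2l // ler_wpM2r ?(ltW wd0) // ler_pdivlMr //.
  by rewrite mulrDl mul1r divfK ?gt_eqF //; lra.
have := quotient_max_modulus gg p0 bound (z := r%:C%C * zeta).
rewrite rnormM zeta1 mulr1 rnorm_real // => /(_ r1).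
rewrite hornerN hornerC rnormBC => /le_trans; apply.
(* At the point of interest the denominator is only [2 d], which turns 3 into 6 and cancels the
   division by [d]. *)
have -> : p.[r%:C%C * zeta] = (2 * d)%:C%C.
  rewrite pE mulrCA zz mulr1 -rmorphB /=; congr (_ %:C)%C.
  by rewrite /d; ring.
rewrite rnorm_real; last by rewrite mulr_ge0 // ltW.
by rewrite le_eqVlt; apply/orP; left; apply/eqP; rewrite -/d; field; rewrite gt_eqF.
Qed.

End DiskAlgebra.

(** * The functional calculus *)

Section FunctionalCalculus.
Variables (R : realType) (H : completeNormedModType R[i]).
Implicit Types (T S : {linear H -> H}) (A : H -> H).

Lemma opnorm_le A (B : R) : (forall x, rnorm x <= 1 -> rnorm (A x) <= B) ->
  (opnorm A <= B%:E)%E.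
Proof. by move=> AB; apply: ge_ereal_sup => _ [x x1 <-]; rewrite lee_fin; exact: AB. Qed.

Lemma le_opnorm A x : rnorm x <= 1 -> ((rnorm (A x))%:E <= opnorm A)%E.
Proof. by move=> x1; apply: ereal_sup_ubound; exists x. Qed.

Lemma opnorm_ge0 A : (0 <= opnorm A)%E.
Proof.
by apply: le_trans (le_opnorm A (x := 0) _); rewrite ?lee_fin ?rnorm_ge0 ?rnorm0.
Qed.

Lemma opnorm_linear T (B : R) : (opnorm T <= B%:E)%E ->
  forall x, rnorm (T x) <= B * rnorm x.
Proof.
move=> TB x; have [x0|x0] := eqVneq (rnorm x) 0.
  by move/rnorm_eq0 : (x0) => ->; rewrite linear0 rnorm0 mulr0.
have xp : 0 < rnorm x by rewrite lt_def x0 rnorm_ge0.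
pose y := (rnorm x)^-1%:C%C *: x.
have y1 : rnorm y <= 1 by rewrite rnormZ rnorm_real ?invr_ge0 ?rnorm_ge0 // mulVf.
have := le_trans (le_opnorm T y1) TB.
rewrite lee_fin linearZ rnormZ rnorm_real ?invr_ge0 ?rnorm_ge0 //.
by rewrite mulrC ler_pdivrMr.
Qed.

Lemma ereal_cvg0_lt (v : nat -> \bar R) (e : R) : (v n @[n --> \oo] --> 0)%E -> 0 < e ->
  \forall n \near \oo, (v n < e%:E)%E.
Proof.
move=> /fine_cvgP[vfin /cvgrPdist_lt ve] e0.
near=> n; have vn : v n \is a fin_num by near: n.
rewrite -(fineK vn) lte_fin; apply: le_lt_trans (ler_norm _) _.
by rewrite -normrN -[- _]add0r; near: n; exact: ve.
Unshelve. all: by end_near. Qed.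

Lemma ereal_cvg0 (v : nat -> \bar R) : (forall n, 0 <= v n)%E ->
  (forall n, v n <= (n.+1%:R^-1)%:E)%E -> (v n @[n --> \oo] --> 0)%E.
Proof.
move=> v0 vn; apply: (@squeeze_cvge _ _ _ _ (fun=> 0%E) v (fun n => (n.+1%:R^-1)%:E)).
- by apply: nearW => n; rewrite v0 vn.
- exact: cvg_cst.
by apply: cvg_EFin; [exact: nearW|exact: cvg_harmonic].
Qed.

Lemma is_fcalc_approx (f : R[i] -> R[i]) T A (e : R) : is_fcalc f T A -> 0 < e ->
  exists p : {poly R[i]}, (forall z, rnorm z <= 1 -> rnorm (p.[z] - f z) <= e) /\
    (forall x, rnorm x <= 1 -> rnorm (poly_act p T x - A x) <= e).
Proof.
move=> [_ [p [pf pA]]] e0.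
have : \forall n \near \oo, (disk_norm (fun z => (p n).[z] - f z)%R < e%:E)%E /\
   (opnorm (poly_op (p n) T \- A)%R < e%:E)%E.
  by near=> n; split; near: n; exact: ereal_cvg0_lt.
move=> [N _ /(_ N (leqnn N))[h1 h2]]; exists (p N); split.
  move=> z z1; rewrite -lee_fin; apply: le_trans (ltW h1).
  apply: ereal_sup_ubound; exists z => //.
  by rewrite /closed_disk /= -rnormE lecR.
by move=> x x1; rewrite -lee_fin; apply: le_trans (ltW h2); exact: le_opnorm.
Unshelve. all: by end_near. Qed.

Variable dot : {dot H for @conjC R[i]}.
Hypothesis Hdot : hilbert_dot dot.

(** By von Neumann's inequality [p n (T) x] is Cauchy with a bound proportional to [|x|], so the
    pointwise limit is also a limit in operator norm. *)
Lemma fcalc_spec (f : R[i] -> R[i]) T : disk_fun f -> (forall u, rnorm (T u) <= rnorm u) ->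
  is_fcalc f T (fcalc f T).
Proof.
move=> ff T1; apply: (@getPex _ [set A | is_fcalc f T A]).
have /choice[p Hp] : forall n, exists p : {poly R[i]},
    forall z, rnorm z <= 1 -> rnorm (p.[z] - f z) <= n.+1%:R^-1.
  by move=> n; apply: disk_fun_density; rewrite // invr_gt0.
have pnm n m x : rnorm (poly_act (p n) T x - poly_act (p m) T x) <=
    (n.+1%:R^-1 + m.+1%:R^-1) * rnorm x.
  rewrite -poly_actB; apply: (vonNeumann_rnorm Hdot) => // z z1.
  rewrite hornerD hornerN (_ : _ - _ = ((p n).[z] - f z) - ((p m).[z] - f z)); last by ring.
  by apply: le_trans (rnormB _ _) _; rewrite lerD ?Hp ?z1.
have small (x : H) (e : R) : 0 < e -> \forall n \near \oo, n.+1%:R^-1 * rnorm x < e.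
  move=> e0; have x1 : 0 < rnorm x + 1 by rewrite ltr_wpDl ?rnorm_ge0.
  have ex : 0 < e / (rnorm x + 1) by rewrite divr_gt0.
  near=> n; have : n.+1%:R^-1 < e / (rnorm x + 1).
    by near: n; exact: near_infty_natSinv_lt (PosNum ex).
  rewrite ltr_pdivlMr //; apply: le_lt_trans.
  by rewrite ler_wpM2l ?invr_ge0 // lerDl.
have cv x : cvg (poly_act (p n) T x @[n --> \oo]).
  apply: cauchy_cvg; apply: cauchy_exP => e /posC[d d0 <-].
  have d2 : 0 < d / 2 by rewrite divr_gt0.
  have [N _ HN] := small x _ d2.
  exists (poly_act (p N) T x).
  have : \forall n \near \oo, ball (poly_act (p N) T x) d%:C%C (poly_act (p n) T x); last by [].
  near=> n; rewrite -ball_normE /ball_ /= rnormP; apply: le_lt_trans (pnm _ _ _) _.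
  rewrite mulrDl (splitr d); apply: ltrD; first by apply: HN => /=.
  by apply: HN => /=; near: n; exact: nbhs_infty_ge.
pose A : H -> H := fun x => lim (poly_act (p n) T x @[n --> \oo]).
have pA n x : rnorm (poly_act (p n) T x - A x) <= n.+1%:R^-1 * rnorm x.
  apply/ler_addgt0Pl => e e0; have e2 : 0 < e / 2 by rewrite divr_gt0.
  have : \forall m \near \oo, rnorm (poly_act (p n) T x - A x) <= e + n.+1%:R^-1 * rnorm x.
    near=> m.
    have h1 : m.+1%:R^-1 * rnorm x < e / 2 by near: m; exact: small.
    have h2 : rnorm (poly_act (p m) T x - A x) < e / 2.
      by near: m; have /cvg_rnormP := cv x; exact.
    rewrite (_ : _ - A x = (poly_act (p n) T x - poly_act (p m) T x) +
        (poly_act (p m) T x - A x)).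
      have := pnm n m x; rewrite mulrDl => h3.
      apply: le_trans (rnormD _ _) _; apply: le_trans (lerD h3 (ltW h2)) _.
      by rewrite -addrA addrC lerD2r [leRHS](splitr e) lerD2r; exact: ltW h1.
    by rewrite addrA subrK.
  by move=> /filter_ex[].
exists A; split.
  move=> a x y; apply: cvg_lim => //.
  have -> : (fun n => poly_act (p n) T (a *: x + y)) =
      (fun n => a *: poly_act (p n) T x + poly_act (p n) T y).
    by apply/funext => n; rewrite poly_act_linear.
  by apply: cvgD; [apply: cvgZr; exact: cv|exact: cv].
exists p; split; apply: ereal_cvg0.
- move=> n; apply: le_trans (_ : 0 <= (rnorm ((p n).[0] - f 0))%:E)%E _.
    by rewrite lee_fin rnorm_ge0.
  by apply: ereal_sup_ubound; exists 0 => //; rewrite /closed_disk /= normr0 ler01.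
- move=> n; apply: ge_ereal_sup => _ [z z1 <-]; rewrite lee_fin Hp //.
  by rewrite -lecR rnormE.
- by move=> n; exact: opnorm_ge0.
move=> n; apply: opnorm_le => x x1; apply: le_trans (pA n x) _.
by rewrite ler_piMr ?invr_ge0.
Unshelve. all: by end_near. Qed.

(** [is_fcalc] supplies approximating polynomials [p] for [T] and [q] for [S] separately. The
    polynomial estimate is applied to [p], and von Neumann's inequality bridges [p(S)] and
    [q(S)]. *)
Lemma fcalc_modulus (f : R[i] -> R[i]) T S (W : R -> R) (d : R) N x :
  disk_fun f ->
  (forall u, rnorm (T u) <= rnorm u) -> (forall u, rnorm (S u) <= rnorm u) ->
  (forall a b : R, 0 <= a -> a <= b -> W a <= W b) ->
  (forall (z : R[i]) (r : R), rnorm z = 1 -> 0 <= r -> r <= 1 ->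
    rnorm (f z - f (r%:C%C * z)) <= W (1 - r)) ->
  0 < d -> (forall u, rnorm (T u - S u) <= d * rnorm u) -> rnorm x <= 1 ->
  rnorm (fcalc f T x - fcalc f S x) <=
    \sum_(k < N) 8 * W (2^-1 ^+ k) / 2^-1 ^+ k * d + 2 * W (2^-1 ^+ N).
Proof.
move=> ff T1 S1 Wmono fW d0 TS x1.
have hN n : 0 < (2^-1 : R) ^+ n /\ (2^-1 : R) ^+ n <= 1.
  by split; rewrite ?exprn_gt0 ?exprn_ile1 // ?invr_ge0 // invf_le1 // ler1n.
(* The errors add up to [e * K]: [e] for each functional calculus, [2 e] between [p] and [q], and
   [e * (K - 4)] from the radial modulus [W + 2 e] of [p]. *)
pose K := \sum_(k < N) 8 * 2 / 2^-1 ^+ k * d + 8.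
have K0 : 0 < K.
  rewrite ltr_wpDl // sumr_ge0 // => k _.
  by rewrite !mulr_ge0 ?(ltW d0) // invr_ge0 ltW //; case: (hN k).
apply/ler_addgt0Pl => e0 e00; pose e := e0 / K; have e_gt0 : 0 < e by rewrite divr_gt0.
have [p [pf pT]] := is_fcalc_approx (fcalc_spec ff T1) e_gt0.
have [q [qf qS]] := is_fcalc_approx (fcalc_spec ff S1) e_gt0.
have pW (z : R[i]) (r : R) : rnorm z = 1 -> 0 <= r -> r <= 1 ->
    rnorm (p.[z] - p.[r%:C%C * z]) <= W (1 - r) + 2 * e.
  move=> z1 r0 r1; have h1 := fW z r z1 r0 r1.
  have h2 : rnorm (p.[z] - f z) <= e by apply: pf; rewrite z1.
  have h3 : rnorm (p.[r%:C%C * z] - f (r%:C%C * z)) <= e.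
    by apply: pf; rewrite rnormM z1 mulr1 rnorm_real.
  rewrite (_ : _ - _ = (p.[z] - f z) + (f z - f (r%:C%C * z)) -
    (p.[r%:C%C * z] - f (r%:C%C * z))); last by ring.
  apply: le_trans (rnormB _ _) _; apply: le_trans (lerD (rnormD _ _) (lexx _)) _; lra.
have B1 := poly_act_modulus Hdot T1 S1 Wmono pW d0 TS N x.
have B2 : rnorm (poly_act p S x - poly_act q S x) <= 2 * e * rnorm x.
  rewrite -poly_actB; apply: (vonNeumann_rnorm Hdot) => // z z1.
  rewrite hornerD hornerN (_ : _ - _ = (p.[z] - f z) - (q.[z] - f z)); last by ring.
  apply: le_trans (rnormB _ _) _.
  have := pf z; have := qf z; rewrite z1 => /(_ (lexx _)) + /(_ (lexx _)); lra.
have B3 := pT x x1; have B4 := qS x x1.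
have -> : fcalc f T x - fcalc f S x = - (poly_act p T x - fcalc f T x) +
   (poly_act p T x - poly_act p S x) + (poly_act p S x - poly_act q S x) +
   (poly_act q S x - fcalc f S x).
  by rewrite opprB !addrA !subrK.
have M1 : (\sum_(k < N) 8 * (W (2^-1 ^+ k) + 2 * e) / 2^-1 ^+ k * d
   + 2 * (W (2^-1 ^+ N) + 2 * e)) =
   \sum_(k < N) 8 * W (2^-1 ^+ k) / 2^-1 ^+ k * d + 2 * W (2^-1 ^+ N) + e * (K - 4).
  have -> : \sum_(k < N) 8 * (W (2^-1 ^+ k) + 2 * e) / 2^-1 ^+ k * d =
      \sum_(k < N) 8 * W (2^-1 ^+ k) / 2^-1 ^+ k * d + e * (K - 8).
    rewrite /K addrK mulr_sumr -big_split /=; apply: eq_bigr => k _.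
    by move: (W _) (2^-1 ^+ k)^-1 (e) => u v t; ring.
  by move: (\sum_(k < N) _) (W _) (e) (K) => u v t s; ring.
rewrite M1 in B1.
have B5 : 2 * e * rnorm x <= 2 * e by rewrite ler_piMr // mulr_ge0 // ltW.
set Z := \sum_(k < N) _ + _ in B1 *.
have W0 n : 0 <= W (2^-1 ^+ n).
  have [h0 h1] := hN n; rewrite -(subKr 1 (2^-1 ^+ n)).
  by apply: le_trans (rnorm_ge0 _) (fW 1 _ (rnorm1 _) _ _); lra.
have Zp : 0 <= Z + e * (K - 4).
  rewrite addr_ge0 //.
    rewrite /Z addr_ge0 ?mulr_ge0 // sumr_ge0 // => k _.
    by rewrite !mulr_ge0 ?(ltW d0) // invr_ge0 ltW //; case: (hN k).
  rewrite mulr_ge0 ?(ltW e_gt0) // subr_ge0 /K ler_wpDl ?ler_nat // sumr_ge0 // => k _.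
  by rewrite !mulr_ge0 ?(ltW d0) // invr_ge0 ltW //; case: (hN k).
have Z0 : rnorm (poly_act p T x - poly_act p S x) <= Z + e * (K - 4).
  by apply: le_trans B1 _; rewrite ler_piMr.
have eK : e * K = e0 by rewrite /e divfK // gt_eqF.
apply: le_trans (rnormD _ _) _; apply: le_trans (lerD (rnormD _ _) (lexx _)) _.
apply: le_trans (lerD (lerD (rnormD _ _) (lexx _)) (lexx _)) _.
rewrite rnormN; move: Z0 B2 B3 B4 B5 eK; rewrite mulrBr; lra.
Qed.

End FunctionalCalculus.

(** * Dyadic sums and the integral of [w t / t ^+ 2] *)

Section DyadicSum.
Variables (R : realType) (w : R -> R).
Hypothesis wmod : modulus_of_continuity w.

Let mu := @lebesgue_measure R.
Let J (a : R) := (\int[mu]_(t in `[a, +oo[) (w t / t ^+ 2)%:E)%E.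

Let integrand_ge0 (a t : R) : 0 < a -> `[a, +oo[%classic t -> (0 <= (w t / t ^+ 2)%:E)%E.
Proof.
move=> a0; rewrite /= in_itv /= andbT => at_; have [_ _ _ wpos _] := wmod.
by rewrite lee_fin divr_ge0 ?sqr_ge0 // ltW // wpos // (lt_le_trans a0).
Qed.

Let integrand_measurable (a : R) : 0 < a ->
  measurable_fun (`[a, +oo[ : set R) (fun t : R => (w t / t ^+ 2)%:E : \bar R).
Proof.
move=> a0; have [_ wc _ _ _] := wmod.
apply/measurable_EFinP; apply: subspace_continuous_measurable_fun => //.
apply/subspace_continuousP => t; rewrite /= in_itv /= andbT => at_.
have t0 : 0 < t := lt_le_trans a0 at_.
apply: cvgM.
  have sub : `[a, +oo[ `<=` (`[0, +oo[ : set R).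
    by move=> u; rewrite /= !in_itv /= !andbT; apply: le_trans; exact: ltW.
  have := continuous_subspaceW sub wc; move/subspace_continuousP; apply.
  by rewrite /= in_itv /= andbT.
apply: cvgV; first by rewrite sqrf_eq0 gt_eqF.
apply: cvg_within_filter; exact: exprn_continuous.
Qed.

Let J_ge0 (a : R) : 0 < a -> (0 <= J a)%E.
Proof. by move=> a0; apply: integral_ge0 => t; exact: integrand_ge0. Qed.

(** On [[a, 2a)], of length [a], the integrand is at least [w a / (2 a)^2]. *)
Let J_step (a : R) : 0 < a -> ((w a / (4 * a))%:E + J (2 * a) <= J a)%E.
Proof.
move=> a0; have a2 : a < 2 * a by lra.
have [mono _ _ wpos _] := wmod.
have itvE : `[a, +oo[%classic = `[a, (2 * a)[ `|` `[(2 * a), +oo[ :> set R.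
  by rewrite -itv_bndbnd_setU // bnd_simp ltW.
rewrite {2}/J itvE ge0_integral_setU //; first last.
- rewrite disj_set2E; apply/eqP; rewrite -subset0 => t [] /=; rewrite !in_itv /= andbT.
  by move=> /andP[_ h]; rewrite leNgt h.
- by rewrite -itvE => t; exact: integrand_ge0.
- by rewrite -itvE; exact: integrand_measurable.
apply: leeD => //.
have -> : (w a / (4 * a))%:E = (\int[mu]_(t in `[a, (2 * a)%R[) cst (w a / (4 * a ^+ 2))%:E t)%E.
  rewrite integral_cst //= lebesgue_measure_itv /= lte_fin a2 -EFinB -EFinM; congr (_%:E).
  by field; rewrite gt_eqF.
apply: ge0_le_integral => //.
- by move=> t _; rewrite lee_fin divr_ge0 ?mulr_ge0 ?sqr_ge0 // ltW // wpos.
- apply: measurable_funS (integrand_measurable a0) => //.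
  by rewrite itvE; exact: subsetUl.
move=> t; rewrite /= in_itv /= => /andP[at_ ta]; rewrite lee_fin.
have t0 : 0 < t := lt_le_trans a0 at_.
apply: ler_pM.
- by rewrite ltW // wpos.
- by rewrite invr_ge0 mulr_ge0 ?sqr_ge0.
- by apply: mono => //; rewrite in_itv /= andbT ltW.
rewrite (_ : 4 * a ^+ 2 = (2 * a) ^+ 2); last by ring.
have aa : 0 < 2 * a by rewrite mulr_gt0.
by rewrite lef_pV2 ?posrE ?exprn_gt0 // lerXn2r ?nnegrE // ltW.
Qed.

Let J_anti (a b : R) : 0 < a -> a <= b -> (J b <= J a)%E.
Proof.
move=> a0 ab; apply: ge0_subset_integral => //.
- exact: integrand_measurable.
- by move=> t; exact: integrand_ge0.
by move=> t; rewrite /= !in_itv /= !andbT; exact: le_trans.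
Qed.

Let half_pow k : 0 < (2^-1 : R) ^+ k. Proof. by rewrite exprn_gt0 // invr_gt0. Qed.

Lemma dyadic_sum_le (d : R) N : 0 < d -> (forall k, (k < N)%N -> d <= 2^-1 ^+ k) ->
  ((\sum_(k < N) w (2^-1 ^+ k) / 2^-1 ^+ k)%:E <= 4%:E * J d)%E.
Proof.
move=> d0 dk; have S n : ((\sum_(k < n) w (2^-1 ^+ k) / (4 * 2^-1 ^+ k))%:E <=
    J (2 * 2^-1 ^+ n))%E.
  elim: n => [|n IH]; first by rewrite big_ord0 J_ge0 // mulr_gt0.
  rewrite big_ord_recr /= EFinD [2^-1 ^+ n.+1]exprS mulrA mulfV // mul1r.
  apply: le_trans (J_step (half_pow n)); rewrite addeC; exact: leeD.
have -> : (\sum_(k < N) w (2^-1 ^+ k) / 2^-1 ^+ k)%:E =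
    (4%:E * (\sum_(k < N) w (2^-1 ^+ k) / (4 * 2^-1 ^+ k))%:E)%E.
  rewrite -EFinM mulr_sumr; congr (_%:E); apply: eq_bigr => k _.
  by rewrite invfM; field; rewrite gt_eqF.
apply: lee_wpmul2l; first by rewrite lee_fin.
(* For a nonempty sum [2 * 2^-1 ^+ N.+1] is the last dyadic point and bounds [d] from above; for an
   empty one nothing relates [d] to 2. *)
case: N dk S => [|N] dk S; first by rewrite big_ord0 J_ge0.
apply: le_trans (S _) _; apply: J_anti => //.
by rewrite exprS mulrA mulfV // mul1r; exact: dk.
Qed.

Lemma modulus_le_integral (d : R) : 0 < d -> ((w d / d)%:E <= 4%:E * J d)%E.
Proof.
move=> d0; have -> : (w d / d)%:E = (4%:E * (w d / (4 * d))%:E)%E.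
  by rewrite -EFinM; congr (_%:E); field; rewrite gt_eqF.
apply: lee_wpmul2l; first by rewrite lee_fin.
by apply: le_trans (J_step d0); rewrite leeDl // J_ge0 // mulr_gt0.
Qed.

End DyadicSum.

(** * From the norm of [f] to the operator estimate *)

Lemma Lambda_norm_bound (R : realType) (w : R -> R) (f : R[i] -> R[i]) :
  modulus_of_continuity w -> (Lambda_norm w f < +oo)%E ->
  exists L : R, [/\ 0 <= L, Lambda_norm w f = L%:E &
    forall z u : R[i], rnorm z = 1 -> rnorm u = 1 -> rnorm (f z - f u) <= L * w (rnorm (z - u))].
Proof.
move=> wmod Lfin; have [_ _ w0 wpos _] := wmod.
have ub (z u : R[i]) : rnorm z = 1 -> rnorm u = 1 -> z != u ->
    ((rnorm (f z - f u) / w (rnorm (z - u)))%:E <= Lambda_norm w f)%E.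
  move=> z1 u1 zu; apply: ereal_sup_ubound; exists (z, u) => //.
  by split=> //; apply/rnorm_eq1.
have np (z u : R[i]) : z != u -> 0 < rnorm (z - u).
  move=> zu; rewrite lt_def rnorm_ge0 andbT; apply: contra_neq zu => /rnorm_eq0/eqP.
  by rewrite subr_eq0 => /eqP.
have L0 : (0 <= Lambda_norm w f)%E.
  (* The pair [1], [-1] witnesses that the supremum is not over the empty set, where it would be
     [-oo]. *)
  apply: le_trans (ub 1 (-1) (rnorm1 _) _ _).
  - by rewrite lee_fin divr_ge0 ?rnorm_ge0 // ltW // wpos // np // -addr_eq0 -mulr2n pnatr_eq0.
  - by rewrite rnormN rnorm1.
  by rewrite -addr_eq0 -mulr2n pnatr_eq0.
have LE : Lambda_norm w f = (fine (Lambda_norm w f))%:E.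
  by rewrite fineK // ge0_fin_numE.
exists (fine (Lambda_norm w f)); split=> //; first exact: fine_ge0.
move=> z u z1 u1; have [->|zu] := eqVneq z u.
  by rewrite !subrr !rnorm0 w0 mulr0.
have := ub z u z1 u1 zu; rewrite LE lee_fin ler_pdivrMr //.
by rewrite wpos // np.
Qed.

Theorem theorem7p7 (R : realType) :
  exists c : R, 0 < c /\
    forall w : R -> R, modulus_of_continuity w ->
    forall f : R[i] -> R[i], Lambda_plus w f ->
    forall (H : completeNormedModType R[i]) (dot : {dot H for @conjC R[i]}),
      hilbert_dot dot ->
    forall T S : {linear H -> H}, contraction_op T -> contraction_op S ->
      (opnorm (fcalc f T \- fcalc f S)%R
         <= c%:E * Lambda_norm w f * omega_star w (fine (opnorm (T \- S)%R)))%E.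
Proof.
(* [240 = 4 * (8 * 6 + 2 * 6)]: 6 from the radial estimate, 8 from each increment, 2 from the
   remainder, and 4 from the comparison with the integral. *)
exists 240; split=> // w wmod f [Lfin fdisk] H dot Hdot T S T1 S1.
have [L [L0 LE fL]] := Lambda_norm_bound wmod Lfin.
have ff := disk_algebra_fun fdisk.
have [mono _ _ wpos _] := wmod.
have {}T1 u : rnorm (T u) <= rnorm u by rewrite -[leRHS]mul1r; exact: opnorm_linear.
have {}S1 u : rnorm (S u) <= rnorm u by rewrite -[leRHS]mul1r; exact: opnorm_linear.
rewrite LE; set D := opnorm (T \- S)%R; set d := fine D.
have Dfin : D \is a fin_num.
  rewrite ge0_fin_numE ?opnorm_ge0 //; apply: (@le_lt_trans _ _ 2%:E); last exact: ltry.
  apply: opnorm_le => x x1; apply: le_trans (rnormB _ _) _.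
  by have := T1 x; have := S1 x; lra.
have DE : D = d%:E by rewrite /d fineK.
have d_ge0 : 0 <= d by rewrite fine_ge0 ?opnorm_ge0.
have TS u : rnorm (T u - S u) <= d * rnorm u.
  by apply: (opnorm_linear (T := T \- S)); rewrite -/D DE.
rewrite /omega_star; have [d0|d0] := eqVneq d 0.
  have TSE : (T : H -> H) = S.
    apply/funext => u; apply/eqP; rewrite -subr_eq0; apply/eqP/rnorm_eq0/eqP.
    by rewrite eq_le rnorm_ge0 andbT -(mul0r (rnorm u)) -d0.
  by rewrite mule0 TSE; apply: opnorm_le => x _; rewrite /= subrr rnorm0.
have {d_ge0}dp : 0 < d by rewrite lt_def d0.
(* The least such [N] serves both ends: the remainder is controlled by [w d], and the dyadic points
   of the sum stay in the range of integration. *)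
have [N Nd Nmin] : exists2 N, (2^-1 : R) ^+ N <= d & forall k, (k < N)%N -> d <= 2^-1 ^+ k.
  have h2 : `|2^-1 : R| < 1 by rewrite ger0_norm ?invr_ge0 // invf_lt1 // ltr1n.
  have /cvgrPdist_lt/(_ _ dp)[M _ HM] := cvg_expr h2.
  have exN : exists n, (2^-1 : R) ^+ n <= d.
    exists M; have := HM M (leqnn M); rewrite /= sub0r normrN => h.
    exact: le_trans (ler_norm _) (ltW h).
  case: (ex_minnP exN) => N Nd Nmin; exists N => // k kN.
  by rewrite leNgt; apply/negP => /ltW/Nmin; rewrite leqNgt kN.
have s_le := dyadic_sum_le wmod dp Nmin; have w_le := modulus_le_integral wmod dp.
set s := \sum_(k < N) _ in s_le.
apply: (@le_trans _ _ (48 * L * d * s + 12 * L * w d)%:E).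
  apply: opnorm_le => x x1 /=.
  have Wmono (a b : R) : 0 <= a -> a <= b -> 6 * L * w a <= 6 * L * w b.
    move=> a0 ab; apply: ler_wpM2l; first by rewrite mulr_ge0.
    by apply: mono; rewrite // in_itv /= andbT // (le_trans a0).
  have fW (z : R[i]) (r : R) : rnorm z = 1 -> 0 <= r -> r <= 1 ->
      rnorm (f z - f (r%:C%C * z)) <= 6 * L * w (1 - r).
    by move=> z1 r0 r1; exact: hardy_littlewood.
  have B := fcalc_modulus Hdot N ff T1 S1 Wmono fW dp TS x1.
  apply: le_trans B _.
  apply: lerD.
    rewrite /s mulr_sumr le_eqVlt; apply/orP; left; apply/eqP.
    by apply: eq_bigr => k _; move: (w _) (_ ^+ k)^-1 => a b; ring.
  rewrite (_ : 2 * _ = 12 * L * w (2^-1 ^+ N)); last by ring.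
  apply: ler_wpM2l; first by rewrite mulr_ge0.
  apply: mono => //; rewrite in_itv /= andbT ?(ltW dp) //.
move: s_le w_le; case: (\int[_]_(t in _) _)%E => [J| |].
- rewrite -!EFinM !lee_fin => s_le; rewrite ler_pdivrMr // => w_le.
  have h1 : 48 * L * d * s <= 48 * L * d * (4 * J).
    by apply: ler_wpM2l s_le; rewrite !mulr_ge0 // ltW.
  have h2 : 12 * L * w d <= 12 * L * (4 * J * d).
    by apply: ler_wpM2l w_le; rewrite mulr_ge0.
  apply: le_trans (lerD h1 h2) _; rewrite le_eqVlt; apply/orP; left; apply/eqP; ring.
(* When the integral diverges the right-hand side is [+oo], except for [L = 0], where the convention
   [0 * +oo = 0] makes it 0 and the left-hand bound is 0 as well. *)
- move=> _ _; have [L_eq0|Lne0] := eqVneq L 0.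
    by rewrite L_eq0 !(mulr0, mul0r, mule0, mul0e) addr0.
  rewrite gt0_muley ?lte_fin // -EFinM gt0_muley ?leey // lte_fin.
  by rewrite mulr_gt0 // lt_def Lne0.
by rewrite gt0_muleNy ?lte_fin // leeNy_eq => /eqP.
Qed.
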